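(* Let $p,q\in(0,\infty)$ and $\mathbf u=\{u_n\},\mathbf v=\{v_n\},\mathbf w=\{w_n\}\in\mathbb R_+^{\mathbb Z}$. For $n\in\mathbb Z$ put $\hat u_n=\sup_{k\ge n}u_k$. Let $C_1\in[0,\infty]$ be the least constant such that $$\Bigg(\sum_{n\in\mathbb Z}\Bigg(\sup_{i\ge n}u_i\sum_{k\le i}a_k\Bigg)^{q}w_n\Bigg)^{\frac1q}\le C_1\Bigg(\sum_{n\in\mathbb Z}a_n^pv_n\Bigg)^{\frac1p}$$ holds for all $\mathbf a=\{a_n\}\in\mathbb R_+^{\mathbb Z}$. Then $C_1$ admits the following estimates. (i) If $1<p\le q$, then $$C_1\approx\sup_{n\in\mathbb Z}\Bigg(\hat u_n^q\sum_{i\le n}w_i+\sum_{i\ge n}\hat u_i^{q}w_i\Bigg)^{\frac1q}\Bigg(\sum_{k\le n}v_k^{\frac1{1-p}}\Bigg)^{\frac{p-1}p}.$$ (ii) If $p>1$ and $q<p$, then $$C_1\approx\Bigg(\sum_{n\in\mathbb Z}\Bigg(\sum_{i\ge n}\hat u_i^qw_i\Bigg)^{\frac q{p-q}}\hat u_n^{q}w_n\Bigg(\sum_{k\le n}v_k^{\frac1{1-p}}\Bigg)^{\frac{(p-1)q}{p-q}}\Bigg)^{\frac{p-q}{pq}}+\Bigg(\sum_{n\in\mathbb Z}\Bigg(\sum_{i\le n}w_i\Bigg)^{\frac q{p-q}}w_n\sup_{k\ge n}\hat u_k^{\frac{pq}{p-q}}\Bigg(\sum_{j\le k}v_j^{\frac1{1-p}}\Bigg)^{\frac{(p-1)q}{p-q}}\Bigg)^{\frac{p-q}{pq}}.$$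 (iii) If $0<p\le1$ and $p\le q$, then $$C_1\approx\sup_{n\in\mathbb Z}\Bigg(\hat u_n^q\sum_{i\le n}w_i+\sum_{k\ge n}\hat u_k^qw_k\Bigg)^{\frac1q}\sup_{j\le n}v_j^{-\frac1p}.$$ (iv) If $0<q<p\le1$, then $$C_1\approx\Bigg(\sum_{n\in\mathbb Z}\Bigg(\sum_{i\ge n}w_i\hat u_i^q\Bigg)^{\frac q{p-q}}\hat u_n^{q}w_n\sup_{k\le n}v_k^{\frac q{q-p}}+\sum_{n\in\mathbb Z}\Bigg(\sum_{i\le n}w_i\Bigg)^{\frac q{p-q}}w_n\sup_{k\ge n}\hat u_k^{\frac{pq}{p-q}}v_k^{\frac q{q-p}}\Bigg)^{\frac{p-q}{pq}}.$$
   Context: $\mathbb R_+^{\mathbb Z}$ denotes the set of all double-infinite sequences $\{a_n\}_{n\in\mathbb Z}$ of nonnegative real numbers. For $A,B\in[0,\infty]$, $A\lesssim B$ means that there is a constant $C\in(0,\infty)$ depending only on $p$ and $q$ (in particular not on $\mathbf u,\mathbf v,\mathbf w$) such that $A\le CB$; $A\approx B$ means $A\lesssim B\lesssim A$. If no finite constant makes the inequality valid for all $\mathbf a$, the least constant is $\infty$. Sums and suprema take values in $[0,\infty]$, with the conventions $0^{-\alpha}=\infty$, $\infty^{-\alpha}=0$ for $\alpha>0$, and $0\cdot\infty=0$. *)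

(* Defs.v *)
From HB Require Import structures.
From mathcomp Require Import all_boot all_order all_algebra.
From mathcomp Require Import all_classical all_reals all_analysis.

Set Implicit Arguments.
Unset Strict Implicit.
Unset Printing Implicit Defensive.

Import Order.TTheory GRing.Theory Num.Theory.
Import numFieldNormedType.Exports.

Local Open Scope classical_set_scope.
Local Open Scope ring_scope.
Local Open Scope ereal_scope.

(* All sums are unordered sums [esum] of nonnegative terms in [\bar R] and all
   suprema are [ereal_sup]; in [\bar R], 0 * +oo = 0. *)

Definition nonneg_seq {R : realType} (a : int -> R) : Prop :=
  forall n : int, (0 <= a n)%R.

(* [poweR] satisfies 0 `^ r = 0 and +oo `^ r = +oo also for r < 0. This variant
   follows the conventions 0 ^ r = +oo and +oo ^ r = 0 for r < 0, and agrees
   with [poweR] for r >= 0. *)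
Definition epow {R : realType} (x : \bar R) (r : R) : \bar R :=
  if (0 <= r)%R then x `^ r else (x `^ (- r))^-1.

Definition uhat {R : realType} (u : int -> R) (n : int) : \bar R :=
  ereal_sup [set (u k)%:E | k in `[n, +oo[].

Definition hardy_lhs {R : realType} (q : R) (u w a : int -> R) : \bar R :=
  (\esum_(n in [set: int])
     ((ereal_sup [set (u i)%:E * (\esum_(k in `]-oo, i]) (a k)%:E)
                 | i in `[n, +oo[]) `^ q * (w n)%:E)) `^ (1 / q).

Definition hardy_rhs {R : realType} (p : R) (v a : int -> R) : \bar R :=
  (\esum_(n in [set: int]) ((a n)%:E `^ p * (v n)%:E)) `^ (1 / p).

(* The infimum ranges over finite constants, so it is +oo when there is no
   admissible one. *)
Definition best_const {R : realType} (p q : R) (u v w : int -> R) : \bar R :=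
  ereal_inf [set C%:E | C in [set C : R | (0 <= C)%R /\
    forall a : int -> R, nonneg_seq a ->
      hardy_lhs q u w a <= C%:E * hardy_rhs p v a]].

(* The constant is uniform in the three sequences. *)
Definition lesssim_unif {R : realType}
    (F G : (int -> R) -> (int -> R) -> (int -> R) -> \bar R) : Prop :=
  exists C : R, (0 < C)%R /\
    forall u v w : int -> R, nonneg_seq u -> nonneg_seq v -> nonneg_seq w ->
      F u v w <= C%:E * G u v w.

Definition approx_unif {R : realType}
    (F G : (int -> R) -> (int -> R) -> (int -> R) -> \bar R) : Prop :=
  lesssim_unif F G /\ lesssim_unif G F.

(* Main.v *)
(* Write U for [uhat u], th = q / p, and let A be the partial sums of a. Since A
   is nondecreasing, u may be replaced by the nonincreasing U in the supremum,
   and summation by parts gives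
     sup_{i >= n} (U_i A_i)^p <= U_n^p A_n^p + sum_{k >= n} U_k^p D(A^p)_k,
   where D is the backward difference. The weight v enters only through a
   sequence kap with D(A^p)_k <= kap_k c_k and sum c <~ sum a^p v: for p > 1,
   kap_k = (sum_{j <= k} v_j^(1/(1-p)))^(p-1) works by Hardy's inequality, for
   p <= 1, kap_k = max_{j <= k} 1/v_j and c = a^p v. This leaves two mirror
   images of a weighted Hardy inequality with exponents 1 and th. For th >= 1
   it is Jensen's inequality; for th < 1 it is Hoelder's inequality with power
   weights of the partial sums of the weight.

   Conversely, each kap_k is attained by a sequence a^(k) of norm at most 1
   supported on j <= k, and max_k eps_k^(1/p) a^(k) has norm to the p at most
   sum eps. Testing with it reduces the lower bounds for th < 1 to a choice of
   eps, which is supported where the relevant supremum doubles.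

   All of this is done for real sequences on {0, ..., M - 1} with v > 0. The
   general case is the limit of the windows [-N, N] with v replaced by
   v + e/(N+1): in [0, +oo] with 0 * +oo = 0, every expression in the statement
   is the supremum of its truncations, because sums, products, suprema and
   positive powers commute with monotone limits. *)
Require Import Defs.
From HB Require Import structures.
From mathcomp Require Import all_boot all_order all_algebra.
From mathcomp Require Import all_classical all_reals all_analysis.
From mathcomp Require Import ring lra zify.

Set Implicit Arguments.
Unset Strict Implicit.
Unset Printing Implicit Defensive.

Import Order.TTheory GRing.Theory Num.Theory.
Import numFieldNormedType.Exports.

Local Open Scope classical_set_scope.
Local Open Scope ring_scope.

(** * Inequalities for real powers *)

Section PowerInequalities.
Context {R : realType}.
Implicit Types x y p r t : R.

(** Young's inequality for the conjugate exponents 1/t and 1/(1-t), applied to x^t and y^(1-t). *)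
Lemma young_powR x y t : 0 <= x -> 0 <= y -> 0 < t < 1 ->
  x `^ t * y `^ (1 - t) <= t * x + (1 - t) * y.
Proof.
move=> x0 y0 /andP[t0 t1]; have s0 : 0 < 1 - t by rewrite subr_gt0.
have := @conjugate_powR R (x `^ t) (y `^ (1 - t)) t^-1 (1 - t)^-1
  (powR_ge0 _ _) (powR_ge0 _ _).
rewrite !invr_gt0 !invrK t0 s0 -!powRrM !mulfV ?gt_eqF// !powRr1//.
by rewrite [x * _]mulrC [y * _]mulrC; apply; rewrite ?subrKC.
Qed.

(** Convexity of the p-th power: its graph lies above the tangent at x. For p > 1 this is Young's
    inequality with t = 1/p, applied to y^p and x^p. *)
Lemma powR_tangent_ge x y p : 0 <= x -> 0 <= y -> 1 <= p ->
  p * x `^ (p - 1) * y <= y `^ p + (p - 1) * x `^ p.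
Proof.
move=> x0 y0; rewrite le_eqVlt => /predU1P[<-|p1].
  by rewrite subrr powRr0 !mul1r mul0r addr0 powRr1.
have p0 : 0 < p by rewrite (lt_trans ltr01).
have /(young_powR (powR_ge0 y p) (powR_ge0 x p)) : 0 < p^-1 < 1.
  by rewrite invr_gt0 p0 invf_lt1.
have pV : p * (1 - p^-1) = p - 1 by rewrite mulrBr mulr1 mulfV ?gt_eqF.
rewrite -!powRrM pV mulfV ?gt_eqF// powRr1// -(ler_pM2l p0).
rewrite [leRHS]mulrDr !mulrA pV mulfV ?gt_eqF// mul1r.
by rewrite mulrAC.
Qed.

Lemma subr_powR_le x y p : 0 <= x -> 0 <= y -> 1 <= p ->
  x `^ p - y `^ p <= p * x `^ (p - 1) * (x - y).
Proof.
move=> x0 y0 p1; have := powR_tangent_ge x0 y0 p1.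
have p0 : 0 < p by rewrite (lt_le_trans ltr01).
rewrite mulrBr -[p * x `^ _ * x]mulrA [_ * x]mulrC mulr_powRB1//; lra.
Qed.

Lemma powR_le_mul x y t : 0 <= y <= x -> 0 < t <= 1 ->
  y * x `^ (t - 1) <= y `^ t.
Proof.
move=> /andP[y0 yx] /andP[t0 t1].
have [->|y_neq0] := eqVneq y 0; first by rewrite mul0r powR_ge0.
have {}y0 : 0 < y by rewrite lt_neqAle eq_sym y_neq0.
rewrite -(mulr_powRB1 (ltW y0) t0) ler_pM2l// -opprB !powRN.
rewrite lef_pV2 ?posrE ?powR_gt0 ?(lt_le_trans y0)//.
by rewrite ge0_ler_powR ?nnegrE ?subr_ge0// ltW// (lt_le_trans y0).
Qed.

Lemma subr_powR_le1 x y t : 0 <= y <= x -> 0 < t <= 1 ->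
  x `^ t - y `^ t <= x `^ (t - 1) * (x - y).
Proof.
move=> yx /[dup] /andP[t0 _] t1; have := powR_le_mul yx t1.
case/andP: yx => y0 yx.
by rewrite mulrBr [_ * x]mulrC mulr_powRB1 ?(le_trans y0)//; lra.
Qed.

(** Concavity of the t-th power: y^t lies below the tangent at x. This is Young's inequality for y^t
    x^(1-t), multiplied by x^(t-1). *)
Lemma mul_subr_le_powR x y t : 0 <= y <= x -> 0 < t <= 1 ->
  x `^ (t - 1) * (x - y) <= t^-1 * (x `^ t - y `^ t).
Proof.
move=> /andP[y0 yx] /andP[t0]; rewrite le_eqVlt => /predU1P[->|t1].
  by rewrite subrr powRr0 mul1r invr1 mul1r !powRr1// (le_trans y0).
have [x0|x_neq0] := eqVneq x 0.
  have y_eq0 : y = 0 by apply/eqP; rewrite eq_le y0 -x0 yx.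
  by rewrite x0 y_eq0 !subrr !mulr0.
have x0 : 0 < x by rewrite lt_neqAle eq_sym x_neq0 (le_trans y0).
have /(young_powR y0 (ltW x0)) : 0 < t < 1 by rewrite t0.
have xt0 : 0 < x `^ (t - 1) by rewrite powR_gt0.
rewrite -(ler_pM2r xt0) -mulrA -powRD ?x_neq0 ?implybT//.
have -> : 1 - t + (t - 1) = 0 by ring.
rewrite powRr0 mulr1 mulrDl.
have -> : (1 - t) * x * x `^ (t - 1) = (1 - t) * x `^ t.
  by rewrite -mulrA mulr_powRB1// ltW.
move=> h; rewrite ler_pdivlMl// mulrBr [_ * x]mulrC mulr_powRB1 ?(ltW x0)//.
lra.
Qed.

Lemma powR_addr_le x y t : 0 <= x -> 0 <= y -> 0 < t ->
  (x + y) `^ t <= 2 `^ t * (x `^ t + y `^ t).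
Proof.
move=> x0 y0 t0; wlog xy : x y x0 y0 / y <= x => [hw|].
  by have [/hw|/ltW/hw] := leP y x; [|rewrite addrC [y `^ _ + _]addrC]; apply.
rewrite (@le_trans _ _ (2 `^ t * x `^ t))//.
  rewrite -powRM ?ge0_ler_powR ?nnegrE ?addr_ge0 ?mulr_ge0 ?(ltW t0)//.
  by rewrite mulr_natl mulr2n lerD.
by rewrite ler_pM2l ?powR_gt0// lerDl powR_ge0.
Qed.

Lemma powR_addr_ge x y t : 0 <= x -> 0 <= y -> 0 < t ->
  x `^ t + y `^ t <= 2 * (x + y) `^ t.
Proof.
move=> x0 y0 t0; rewrite mulr_natl mulr2n.
by rewrite lerD// ge0_ler_powR ?nnegrE ?addr_ge0 ?(ltW t0) ?lerDl ?lerDr.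
Qed.

Lemma powR_le_iff x y t : 0 <= x -> 0 <= y -> 0 < t ->
  (x `^ t <= y `^ t) = (x <= y).
Proof.
move=> x0 y0 t0; apply/idP/idP; last first.
  by move=> xy; rewrite ge0_ler_powR ?nnegrE ?(ltW t0).
apply: contraTT; rewrite -!ltNge => yx.
by rewrite gt0_ltr_powR ?nnegrE.
Qed.

Lemma powRrK x t : 0 <= x -> t != 0 -> (x `^ t) `^ t^-1 = x.
Proof. by move=> x0 t0; rewrite -powRrM mulfV// powRr1. Qed.

Lemma powRVK x t : 0 <= x -> t != 0 -> (x `^ t^-1) `^ t = x.
Proof. by move=> x0 t0; rewrite -powRrM mulVf// powRr1. Qed.

(** Young's inequality is summed for the normalized terms f/F and g/G. The cases F = 0 and G = 0,
    where normalizing is impossible, come first; there every product vanishes. *)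
Lemma hoelder_sum (I : eqType) (s : seq I) (P : pred I) (f g : I -> R) t :
  (forall i, 0 <= f i) -> (forall i, 0 <= g i) -> 0 < t < 1 ->
  \sum_(i <- s | P i) f i `^ t * g i `^ (1 - t) <=
  (\sum_(i <- s | P i) f i) `^ t * (\sum_(i <- s | P i) g i) `^ (1 - t).
Proof.
move=> f0 g0 t01; have /andP[t0 t1] := t01.
have s0 : 0 < 1 - t by rewrite subr_gt0.
set F := \sum_(i <- s | P i) f i; set G := \sum_(i <- s | P i) g i.
have F0 : 0 <= F by apply: sumr_ge0.
have G0 : 0 <= G by apply: sumr_ge0.
have null (h : I -> R) (k : I -> R) r : r != 0 -> (forall i, 0 <= h i) ->
    \sum_(i <- s | P i) h i = 0 ->
    \sum_(i <- s | P i) h i `^ r * k i = 0.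
  move=> r0 h0 /eqP; rewrite psumr_eq0// => /allP hs.
  rewrite big_seq_cond big1// => i /andP[/hs/implyP + Pi] => /(_ Pi)/eqP->.
  by rewrite powR0// mul0r.
have [F_eq0|F_neq0] := eqVneq F 0.
  by rewrite null ?gt_eqF// mulr_ge0 ?powR_ge0.
have [G_eq0|G_neq0] := eqVneq G 0.
  under eq_bigr do rewrite mulrC.
  by rewrite null ?gt_eqF// mulr_ge0 ?powR_ge0.
have {}F0 : 0 < F by rewrite lt_neqAle eq_sym F_neq0.
have {}G0 : 0 < G by rewrite lt_neqAle eq_sym G_neq0.
(* The upper bounds given by Young's inequality add up to 1. *)
have sum1 : \sum_(i <- s | P i) (t * (f i / F) + (1 - t) * (g i / G)) = 1.
  by rewrite big_split/= -!mulr_sumr -!mulr_suml !mulfV// !mulr1 subrKC.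
rewrite -[leRHS]mulr1 -[X in _ <= _ * X]sum1 mulr_sumr; apply: ler_sum => i _.
have h : (f i / F) `^ t * (g i / G) `^ (1 - t) <=
   t * (f i / F) + (1 - t) * (g i / G).
  by apply: young_powR; rewrite ?divr_ge0// ltW.
apply: le_trans (ler_wpM2l _ h); last by rewrite mulr_ge0 ?powR_ge0.
rewrite mulrACA -!powRM ?divr_ge0 ?(ltW F0) ?(ltW G0)//.
by rewrite ![_ * (_ / _)]mulrC !divfK.
Qed.

End PowerInequalities.

(** * Head and tail sums and maxima of finite sequences *)

Section FiniteSequences.
Context {R : realType}.
Implicit Types (f g h : nat -> R) (M n k : nat).

(** Sequences live on the indices below [M]. The maxima start from 0, which is harmless for
    nonnegative sequences and gives 0 on an empty range. *)
Definition sumle f n := \sum_(0 <= k < n.+1) f k.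
Definition sumge M f n := \sum_(n <= k < M) f k.
Definition maxle f n := \big[Num.max/0]_(0 <= k < n.+1) f k.
Definition maxge M f n := \big[Num.max/0]_(n <= k < M) f k.

Lemma sumle0 f : sumle f 0 = f 0%N.
Proof. by rewrite /sumle big_nat1. Qed.

Lemma sumleS f n : sumle f n.+1 = sumle f n + f n.+1.
Proof. by rewrite /sumle big_nat_recr. Qed.

Lemma sumle_ge0 f n : (forall k, 0 <= f k) -> 0 <= sumle f n.
Proof. by move=> f0; apply: sumr_ge0. Qed.

Lemma sumge_ge0 M f n : (forall k, 0 <= f k) -> 0 <= sumge M f n.
Proof. by move=> f0; apply: sumr_ge0. Qed.

Lemma sumle_mono f n k : (forall k, 0 <= f k) -> (n <= k)%N ->
  sumle f n <= sumle f k.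
Proof.
move=> f0 nk; rewrite /sumle (@big_cat_nat _ _ _ n.+1 0 k.+1)//=.
by rewrite lerDl sumr_ge0.
Qed.

Lemma sumge_mono M f n k : (forall k, 0 <= f k) -> (n <= k)%N ->
  sumge M f k <= sumge M f n.
Proof.
move=> f0 nk; rewrite /sumge; have [kM|Mk] := leqP k M.
  by rewrite (@big_cat_nat _ _ _ k n M)//= lerDr sumr_ge0.
by rewrite big_geq ?sumr_ge0// ltnW.
Qed.

Lemma le_sumle f g n : (forall k, (k <= n)%N -> f k <= g k) ->
  sumle f n <= sumle g n.
Proof. by move=> fg; apply: ler_sum_nat => k /andP[_]; apply: fg. Qed.

Lemma le_sumge M f g n : (forall k, (n <= k < M)%N -> f k <= g k) ->
  sumge M f n <= sumge M g n.
Proof. by move=> fg; apply: ler_sum_nat. Qed.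

Lemma eq_sumge M f g n : (forall k, (n <= k < M)%N -> f k = g k) ->
  sumge M f n = sumge M g n.
Proof. by move=> fg; apply: eq_big_nat. Qed.

Lemma eq_sumle f g n : (forall k, (k <= n)%N -> f k = g k) ->
  sumle f n = sumle g n.
Proof. by move=> fg; apply: eq_big_nat => k /andP[_]; apply: fg. Qed.

Lemma sumgeZ M f n x : sumge M (fun k => x * f k) n = x * sumge M f n.
Proof. by rewrite /sumge mulr_sumr. Qed.

Lemma sumleZ f n x : sumle (fun k => x * f k) n = x * sumle f n.
Proof. by rewrite /sumle mulr_sumr. Qed.

Lemma sumgeD M f g n : sumge M (fun k => f k + g k) n = sumge M f n + sumge M g n.
Proof. by rewrite /sumge big_split. Qed.

Lemma sumge_ge_term M f n k : (forall k, 0 <= f k) -> (n <= k < M)%N ->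
  f k <= sumge M f n.
Proof.
move=> f0 /andP[nk kM]; rewrite /sumge (@big_cat_nat _ _ _ k n M) ?(ltnW kM)//=.
by rewrite [X in _ + X]big_ltn// addrCA lerDl addr_ge0// sumr_ge0.
Qed.

Lemma sumle_ge_term f n k : (forall k, 0 <= f k) -> (k <= n)%N ->
  f k <= sumle f n.
Proof. by move=> f0 kn; apply: (@sumge_ge_term n.+1 f 0). Qed.

(** Both sides sum [F n k] over the triangle n <= k < M. *)
Lemma exchange_sumge_sumle M (F : nat -> nat -> R) :
  sumge M (fun n => sumge M (F n) n) 0 =
  sumge M (fun k => sumle (F ^~ k) k) 0.
Proof.
rewrite /sumge /sumle.
rewrite (eq_big_nat _ _ (F2 := fun n => \sum_(0 <= k < M | (n <= k)%N) F n k));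
  last by move=> n _; rewrite (@big_nat_widenl _ _ _ n 0 M).
rewrite (exchange_big_dep_nat xpredT)//=; apply: eq_big_nat => k /andP[_ kM].
by rewrite (@big_nat_widen _ _ _ 0 k.+1 M).
Qed.

Lemma maxle_ge0 f n : 0 <= maxle f n.
Proof. exact: bigmax_ge_id. Qed.

Lemma maxge_ge0 M f n : 0 <= maxge M f n.
Proof. exact: bigmax_ge_id. Qed.

Lemma maxge_le M f n x : 0 <= x -> (forall k, (n <= k < M)%N -> f k <= x) ->
  maxge M f n <= x.
Proof.
move=> x0 fx; rewrite /maxge big_nat_cond.
elim/big_ind: _ => // [y z yx zx|i]; first by rewrite ge_max yx.
by rewrite andbT => /fx.
Qed.

Lemma maxle_le f n x : 0 <= x -> (forall k, (k <= n)%N -> f k <= x) ->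
  maxle f n <= x.
Proof. by move=> x0 fx; apply: maxge_le => // k /andP[_]; apply: fx. Qed.

Lemma maxge_ge_term M f n k : (n <= k < M)%N -> f k <= maxge M f n.
Proof.
move=> nkM; rewrite /maxge (bigD1_seq k)/= ?mem_index_iota ?iota_uniq//.
by rewrite le_max lexx.
Qed.

Lemma maxle_ge_term f n k : (k <= n)%N -> f k <= maxle f n.
Proof. by move=> kn; apply: (@maxge_ge_term n.+1 f 0). Qed.

Lemma maxge_mono M f n k : (n <= k)%N -> maxge M f k <= maxge M f n.
Proof.
move=> nk; apply: maxge_le (maxge_ge0 _ _ _) _ => j /andP[kj jM].
by apply: maxge_ge_term; rewrite jM (leq_trans nk).
Qed.

Lemma maxle_mono f n k : (n <= k)%N -> maxle f n <= maxle f k.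
Proof.
move=> nk; apply: maxle_le (maxle_ge0 _ _) _ => j jn.
by apply: maxle_ge_term; rewrite (leq_trans jn).
Qed.

Lemma maxleS f n : maxle f n.+1 = Num.max (maxle f n) (f n.+1).
Proof.
apply/eqP; rewrite eq_le ge_max maxle_mono//= maxle_ge_term// andbT.
apply: maxle_le => [|k]; first by rewrite le_max maxle_ge0.
rewrite leq_eqVlt ltnS => /predU1P[->|kn]; first by rewrite le_max lexx orbT.
by rewrite le_max maxle_ge_term.
Qed.

Lemma maxle0 f : 0 <= f 0%N -> maxle f 0 = f 0%N.
Proof. by move=> f0; rewrite /maxle big_nat1_id; apply/max_idPl. Qed.

Lemma eq_maxge M f g n : (forall k, (n <= k < M)%N -> f k = g k) ->
  maxge M f n = maxge M g n.
Proof. by move=> fg; apply: eq_big_nat. Qed.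

Lemma eq_maxle f g n : (forall k, (k <= n)%N -> f k = g k) ->
  maxle f n = maxle g n.
Proof. by move=> fg; apply: eq_big_nat => k /andP[_]; apply: fg. Qed.

Lemma maxge_powR M f n r : 0 < r -> (forall k, 0 <= f k) ->
  maxge M (fun k => f k `^ r) n = (maxge M f n) `^ r.
Proof.
move=> r0 f0; apply/eqP; rewrite eq_le; apply/andP; split.
  apply: maxge_le => [|k nkM]; first exact: powR_ge0.
  by rewrite powR_le_iff// ?maxge_ge0// maxge_ge_term.
rewrite -[leRHS](powRVK _ (lt0r_neq0 r0)) ?maxge_ge0//.
rewrite powR_le_iff ?maxge_ge0 ?powR_ge0//; apply: maxge_le => [|k nkM].
  exact: powR_ge0.
rewrite -[leLHS](powRrK (f0 k) (lt0r_neq0 r0)) powR_le_iff ?powR_ge0 ?invr_gt0 ?maxge_ge0//.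
exact: (@maxge_ge_term M (fun k => f k `^ r)).
Qed.

Lemma maxle_powR f n r : 0 < r -> (forall k, 0 <= f k) ->
  maxle (fun k => f k `^ r) n = (maxle f n) `^ r.
Proof. exact: maxge_powR. Qed.

(** Reversal of the indices below [M]. It exchanges heads and tails, so each inequality about one
    yields its mirror image about the other. *)
Definition flip M f k := f (M - k.+1)%N.

Lemma flipK M f k : (k < M)%N -> flip M (flip M f) k = f k.
Proof. by move=> kM; rewrite /flip; congr f; lia. Qed.

Lemma sumge_flip M f : sumge M (flip M f) 0 = sumge M f 0.
Proof. by rewrite /sumge [RHS]big_nat_rev; apply: eq_big_nat => i; rewrite add0n. Qed.

Lemma sumle_flip M f n : (n < M)%N ->
  sumle (flip M f) n = sumge M f (M - n.+1).
Proof.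
move=> nM; rewrite /sumge big_nat_rev -{1}[(M - n.+1)%N]add0n big_addn.
have -> : (M - (M - n.+1) = n.+1)%N by lia.
by apply: eq_big_nat => i /andP[_ iN]; rewrite /flip; congr f; lia.
Qed.

Lemma maxle_flip M f n : (n < M)%N ->
  maxle (flip M f) n = maxge M f (M - n.+1).
Proof.
move=> nM; rewrite /maxge big_nat_rev.
rewrite -{1}[(M - n.+1)%N]add0n big_addn.
have -> : (M - (M - n.+1) = n.+1)%N by lia.
by apply: eq_big_nat => i /andP[_ iN]; rewrite /flip; congr f; lia.
Qed.

Lemma sumge_flip_at M f n : (n < M)%N ->
  sumge M (flip M f) n = sumle f (M - n.+1).
Proof.
move=> nM; rewrite (@eq_sumle f (flip M (flip M f))).
  by rewrite sumle_flip; [congr sumge; lia|lia].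
by move=> k kn; rewrite flipK//; lia.
Qed.

Lemma maxge_flip M f n : (n < M)%N ->
  maxge M (flip M f) n = maxle f (M - n.+1).
Proof.
move=> nM; rewrite (@eq_maxle f (flip M (flip M f))).
  by rewrite maxle_flip; [congr maxge; lia|lia].
by move=> k kn; rewrite flipK//; lia.
Qed.


(** A lower Riemann sum: [h] at the right endpoint is at most the difference quotient of [F], the
    partial sums of [f] are the nodes, starting at 0, and the increments of [F] telescope. *)
Lemma sumle_increment_le (h F : R -> R) f n : (forall k, 0 <= f k) ->
  (forall x y, 0 <= y <= x -> h x * (x - y) <= F x - F y) ->
  sumle (fun k => h (sumle f k) * f k) n <= F (sumle f n) - F 0.
Proof.
move=> f0 hF; elim: n => [|n ih].
  by rewrite !sumle0 -{2}[f 0%N]subr0 hF// lexx f0.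
rewrite sumleS; have := hF (sumle f n.+1) (sumle f n).
rewrite sumle_ge0// sumle_mono// => /(_ isT).
rewrite {2}sumleS addrAC subrr add0r; lra.
Qed.

Lemma sumle_increment_ge (h F : R -> R) f n : (forall k, 0 <= f k) ->
  (forall x y, 0 <= y <= x -> F x - F y <= h x * (x - y)) ->
  F (sumle f n) - F 0 <= sumle (fun k => h (sumle f k) * f k) n.
Proof.
move=> f0 hF; elim: n => [|n ih].
  by rewrite !sumle0 -{3}[f 0%N]subr0 hF// lexx f0.
rewrite [leRHS]sumleS; have := hF (sumle f n.+1) (sumle f n).
rewrite sumle_ge0// sumle_mono// => /(_ isT).
rewrite {3}sumleS addrAC subrr add0r; lra.
Qed.

End FiniteSequences.

(** * Weighted Hardy inequalities *)

Section WeightedInequalities.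
Context {R : realType}.
Implicit Types (c om rho kap eps : nat -> R) (M n k : nat) (t : R).

(** Discrete form of integrating x^(-t) from 0 to the total weight; the integrand is decreasing and
    sampled at right endpoints. *)
Lemma sumle_powR_sub_le om n t : (forall k, 0 <= om k) -> 0 < t < 1 ->
  sumle (fun k => om k * sumle om k `^ (- t)) n
    <= (1 - t)^-1 * sumle om n `^ (1 - t).
Proof.
move=> om0 /andP[t0 t1]; have s0 : 0 < 1 - t by rewrite subr_gt0.
have := @sumle_increment_le R (fun x => x `^ (- t))
  (fun x => (1 - t)^-1 * x `^ (1 - t)) om n om0.
rewrite powR0 ?gt_eqF// mulr0 subr0.
under [X in _ -> X <= _]eq_sumle do rewrite mulrC.
apply=> x y xy; rewrite -mulrBr.
have := @mul_subr_le_powR R x y (1 - t) xy; rewrite s0 gerBl (ltW t0).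
by have -> : 1 - t - 1 = - t by [ring]; apply.
Qed.

Lemma powR_sumleS_le om n t : (forall k, 0 <= om k) -> 0 < t <= 1 ->
  sumle om n.+1 `^ t <=
  sumle om n `^ t + sumle om n.+1 `^ (t - 1) * om n.+1.
Proof.
move=> om0 t1; have := @subr_powR_le1 R (sumle om n.+1) (sumle om n) t.
rewrite sumle_ge0// sumle_mono// => /(_ isT t1).
by rewrite {3}sumleS addrAC subrr add0r; lra.
Qed.

(** With O the partial sums of [om], the factor [rho k] is bounded for all k >= n by a quantity
    depending on n times O_k^(t-1). The n-th term then factors as al^t be^(1-t), and Hoelder's
    inequality leaves the sums of [al] and [be], which are computed by exchanging the order of
    summation. *)
Lemma hardy_sumge M om rho c t : 0 < t < 1 ->
  (forall k, 0 <= om k) -> (forall k, 0 <= rho k) -> (forall k, 0 <= c k) ->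
  sumge M (fun n => om n * sumge M (fun k => rho k * c k) n `^ t) 0 <=
  (1 - t)^-1 `^ t * 2 `^ (1 - t) * (sumge M c 0 `^ t *
   sumge M (fun n => sumle om n `^ (t / (1 - t)) * om n *
              maxge M (fun k => rho k `^ (t / (1 - t))) n) 0 `^ (1 - t)).
Proof.
move=> t01 om0 rho0 c0; have /andP[t0 t1] := t01.
have s0 : 0 < 1 - t by rewrite subr_gt0.
set g := t / (1 - t); have g0 : 0 < g by rewrite divr_gt0.
have tg : t * g + t = g by rewrite /g; field; rewrite gt_eqF.
pose O := sumle om; have O0 n : 0 <= O n by exact: sumle_ge0.
pose Q := maxge M (fun k => rho k `^ g).
have Q0 n : 0 <= Q n by exact: maxge_ge0.
pose tailO n := sumge M (fun k => O k `^ (t - 1) * om k * Q k) n.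
(* Summation by parts makes [z n] a majorant of Q_m O_m^t for all m >= n; this is [Qz]. *)
pose z n := O n `^ t * Q n + tailO n.
pose T n := sumge M (fun k => O k `^ (t - 1) * c k) n.
have tailO0 n : 0 <= tailO n.
  by apply: sumge_ge0 => k; rewrite !mulr_ge0 ?powR_ge0.
have z0 n : 0 <= z n by rewrite addr_ge0// mulr_ge0 ?powR_ge0.
have T0 n : 0 <= T n by apply: sumge_ge0 => k; rewrite mulr_ge0 ?powR_ge0.
(* The powers of O in [al] and [be] are chosen to cancel in al^t be^(1-t), because t g (1 - t) =
   t^2. *)
pose al n := om n * O n `^ (- t) * T n.
pose be n := om n * O n `^ (t * g) * z n.
have al0 n : 0 <= al n by rewrite !mulr_ge0 ?powR_ge0.
have be0 n : 0 <= be n by rewrite !mulr_ge0 ?powR_ge0.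
have Qz n m : (n <= m < M)%N -> Q m * O m `^ t <= z n.
  move=> /andP[nm mM]; rewrite /z /tailO /sumge (@big_cat_nat _ _ _ m.+1)//=;
    last exact: leqW.
  rewrite addrA ler_wpDr//.
    by apply: sumr_ge0 => k _; rewrite !mulr_ge0 ?powR_ge0.
  elim: m nm mM => [|m ih] nm mM.
    move: nm; rewrite leqn0 => /eqP->.
    by rewrite mulrC lerDl sumr_ge0// => k _; rewrite !mulr_ge0 ?powR_ge0.
  move: nm; rewrite leq_eqVlt => /predU1P[->|nm].
    by rewrite mulrC lerDl sumr_ge0// => k _; rewrite !mulr_ge0 ?powR_ge0.
  (* From m to m + 1, Q does not increase, and the growth of O^t is paid for by the new term of the
     tail. *)
  have := ih nm (ltnW mM); rewrite [X in _ -> _ <= _ + X]big_nat_recr ?leqW//=.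
  have Qle : Q m.+1 <= Q m by exact: maxge_mono.
  move=> {}ih; rewrite addrA; apply: le_trans (lerD ih (lexx _)).
  have h : O m.+1 `^ t <= O m `^ t + O m.+1 `^ (t - 1) * om m.+1.
    by apply: powR_sumleS_le; rewrite ?t0 ?ltW.
  apply: le_trans (ler_wpM2l (Q0 _) h) _.
  rewrite mulrDr [Q m.+1 * (_ * _)]mulrC lerD2r.
  by rewrite ler_wpM2r ?powR_ge0.
have pointwise n : (0 <= n < M)%N ->
    om n * sumge M (fun k => rho k * c k) n `^ t
      <= al n `^ t * be n `^ (1 - t).
  move=> /andP[_ nM]; have [om_eq0|om_neq0] := eqVneq (om n) 0.
    by rewrite om_eq0 mul0r mulr_ge0 ?powR_ge0.
  have omp : 0 < om n by rewrite lt_neqAle eq_sym om_neq0 om0.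
  have Op k : (n <= k)%N -> 0 < O k.
    move=> nk; apply: lt_le_trans omp _.
    by apply: le_trans (sumle_mono om0 nk); apply: sumle_ge_term.
  (* After raising to the power g this reads rho_k^g O_k^t <= z_n, which follows from rho_k^g <= Q_k
     and [Qz]. *)
  have rhoz k : (n <= k < M)%N -> rho k <= z n `^ g^-1 * O k `^ (t - 1).
    move=> /[dup] nkM /andP[nk kM]; have Ok := Op _ nk.
    have -> : t - 1 = - (1 - t) by ring.
    rewrite powRN ler_pdivlMr ?powR_gt0//.
    rewrite -(powR_le_iff _ (powR_ge0 _ _) g0) ?mulr_ge0 ?powR_ge0//.
    rewrite powRVK ?gt_eqF// powRM ?powR_ge0// -powRrM.
    have -> : (1 - t) * g = t by rewrite /g mulrC divfK ?gt_eqF.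
    apply: le_trans (Qz n k nkM); rewrite ler_wpM2r ?powR_ge0//.
    by apply: maxge_ge_term; rewrite leqnn.
  have sumz : sumge M (fun k => rho k * c k) n <= z n `^ g^-1 * T n.
    rewrite /T -sumgeZ; apply: le_sumge => k nkM.
    by rewrite mulrA ler_wpM2r// rhoz.
  have Tt : sumge M (fun k => rho k * c k) n `^ t <= z n `^ (1 - t) * T n `^ t.
    apply: (@le_trans _ _ ((z n `^ g^-1 * T n) `^ t)).
      rewrite powR_le_iff ?mulr_ge0 ?powR_ge0//.
      by apply: sumge_ge0 => k; rewrite mulr_ge0.
    rewrite powRM ?powR_ge0// -powRrM.
    by have -> : g^-1 * t = 1 - t by rewrite /g; field; rewrite !gt_eqF.
  apply: le_trans (ler_wpM2l (om0 n) Tt) _.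
  rewrite /al /be !powRM ?mulr_ge0 ?powR_ge0//.
  rewrite -!powRrM.
  have -> : t * g * (1 - t) = t * t by rewrite /g; field; rewrite gt_eqF.
  rewrite mulNr powRN; have OO : O n `^ (t * t) != 0.
    by rewrite gt_eqF// powR_gt0// Op.
  rewrite -{1}(powRr1 (om0 n)) -{1}(subrKC t 1) powRD ?om_neq0 ?implybT//.
  rewrite le_eqVlt; apply/orP; left; apply/eqP.
  by field.
apply: le_trans (le_sumge pointwise) _.
apply: le_trans (hoelder_sum _ _ al0 be0 t01) _.
set E := sumge M (fun n => O n `^ g * om n * Q n) 0.
have E0 : 0 <= E by apply: sumge_ge0 => n; rewrite !mulr_ge0 ?powR_ge0.
have sum_al : sumge M al 0 <= (1 - t)^-1 * sumge M c 0.
  rewrite -sumgeZ /al.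
  rewrite (@eq_sumge _ _ _ (fun n => sumge M (fun k =>
      om n * O n `^ (- t) * (O k `^ (t - 1) * c k)) n)); last first.
    by move=> n _; rewrite sumgeZ.
  rewrite exchange_sumge_sumle; apply: le_sumge => k _.
  rewrite (@eq_sumle _ _ (fun n => O k `^ (t - 1) * c k * (om n * O n `^ (- t))));
    last by move=> n _; rewrite mulrC.
  rewrite sumleZ.
  have := ler_wpM2l (mulr_ge0 (powR_ge0 (O k) (t - 1)) (c0 k))
    (sumle_powR_sub_le k om0 t01).
  move=> /le_trans; apply; rewrite -/(O k).
  (* Only an inequality, since the product is 0 when [O k] vanishes. *)
  have OO1 : O k `^ (t - 1) * O k `^ (1 - t) <= 1.
    have [->|Ok] := eqVneq (O k) 0.
      by rewrite [X in _ * X]powR0 ?gt_eqF// mulr0 ler01.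
    rewrite -powRD ?Ok ?implybT//.
    by have -> : t - 1 + (1 - t) = 0 by [ring]; rewrite powRr0.
  rewrite [leLHS](_ : _ = (1 - t)^-1 * c k * (O k `^ (t - 1) * O k `^ (1 - t)));
    last by ring.
  by rewrite ler_piMr// mulr_ge0// invr_ge0 ltW.
(* Each of the two summands of [z] contributes at most [E]: the first by t g + t = g, the second
   after exchanging the sums and bounding O_n by O_k for n <= k. *)
have sum_be : sumge M be 0 <= 2 * E.
  rewrite mulr_natl mulr2n /be.
  under eq_sumge do rewrite /z mulrDr.
  rewrite sumgeD lerD//.
    apply: le_sumge => n _; rewrite le_eqVlt; apply/orP; left; apply/eqP.
    rewrite -/(O n) -/(Q n) -[in RHS]tg powRD ?tg ?(gt_eqF g0)//; ring.
  rewrite (@eq_sumge _ M _ (fun n => sumge M (fun k => om n * O n `^ (t * g) *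
      (O k `^ (t - 1) * om k * Q k)) n) 0); last by move=> n _; rewrite sumgeZ.
  rewrite exchange_sumge_sumle; apply: le_sumge => k _.
  rewrite (@eq_sumle _ _ (fun n => O k `^ (t - 1) * om k * Q k *
    (om n * O n `^ (t * g)))); last by move=> n _; rewrite mulrC.
  rewrite sumleZ -/(O k) -/(Q k).
  have := Q0 k; have := om0 k.
  have h : sumle (fun n => om n * O n `^ (t * g)) k <= O k * O k `^ (t * g).
    rewrite [leRHS]mulrC -sumleZ; apply: le_sumle => n nk; rewrite mulrC.
    have tg0 : 0 <= t * g by rewrite mulr_ge0// ltW.
    by rewrite ler_wpM2r// ge0_ler_powR ?nnegrE ?O0// sumle_mono.
  move=> omk Qk.
  apply: le_trans (ler_wpM2l (mulr_ge0 (mulr_ge0 (powR_ge0 _ _) omk) Qk) h) _.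
  have [Ok0|Ok] := eqVneq (O k) 0.
    have -> : om k = 0.
      by apply/eqP; rewrite eq_le omk andbT -Ok0 sumle_ge_term.
    by rewrite !(mulr0, mul0r).
  rewrite [leLHS](_ : _ = O k `^ (t - 1) * O k * O k `^ (t * g) * (om k * Q k));
    last by ring.
  rewrite [X in X * _ * _]mulrC mulr_powRB1// -powRD ?Ok ?implybT//.
  by rewrite addrC tg mulrA.
have c0' : 0 <= sumge M c 0 by apply: sumge_ge0.
apply: (@le_trans _ _ (((1 - t)^-1 * sumge M c 0) `^ t * (2 * E) `^ (1 - t))).
  have A0 : 0 <= sumge M al 0 by apply: sumge_ge0.
  have B0 : 0 <= sumge M be 0 by apply: sumge_ge0.
  apply: ler_pM; rewrite ?powR_ge0//.
    by rewrite powR_le_iff// mulr_ge0// invr_ge0 ltW.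
  by rewrite powR_le_iff// mulr_ge0.
rewrite !powRM ?c0' ?invr_ge0 ?(ltW s0)//.
by rewrite le_eqVlt; apply/orP; left; apply/eqP; ring.
Qed.

(** Jensen's inequality for the measure [c], obtained from Hoelder's inequality with exponent 1/t
    for rho^t c and c. *)
Lemma jensen_sumge M rho c n t : 1 <= t ->
  (forall k, 0 <= rho k) -> (forall k, 0 <= c k) ->
  sumge M (fun k => rho k * c k) n `^ t <=
  sumge M c n `^ (t - 1) * sumge M (fun k => rho k `^ t * c k) n.
Proof.
move=> + rho0 c0; rewrite le_eqVlt => /predU1P[<-|t1].
  rewrite subrr powRr0 mul1r powRr1 ?sumge_ge0// => [|k]; last exact: mulr_ge0.
  by apply: le_sumge => k _; rewrite powRr1.
have t0 : 0 < t by apply: lt_trans t1.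
have t01 : 0 < t^-1 < 1 by rewrite invr_gt0 t0 invf_lt1.
have F0 k : 0 <= rho k `^ t * c k by rewrite mulr_ge0 ?powR_ge0.
have := hoelder_sum (index_iota n M) xpredT F0 c0 t01.
have S0 : 0 <= sumge M (fun k => rho k * c k) n.
  by apply: sumge_ge0 => k; rewrite mulr_ge0.
rewrite (eq_bigr (fun k => rho k * c k)); last first.
  move=> k _; rewrite powRM ?powR_ge0// powRrK ?gt_eqF// -mulrA.
  have [->|ck] := eqVneq (c k) 0.
    by rewrite powR0 ?gt_eqF ?invr_gt0// !(mul0r, mulr0).
  by rewrite -powRD ?ck ?implybT// subrKC powRr1.
rewrite -(powR_le_iff S0 _ t0); last by rewrite mulr_ge0 ?powR_ge0.
rewrite powRM ?powR_ge0// powRVK ?gt_eqF ?sumge_ge0// -powRrM mulrC.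
by have -> : (1 - t^-1) * t = t - 1 by rewrite mulrBl mulVf ?gt_eqF ?mul1r.
Qed.

(** After Jensen's inequality the tail of [c] is enlarged to the full sum. Exchanging the sums then
    produces exactly the products bounded by [B]. *)
Lemma hardy_sumge_ge1 M om rho c B t : 1 <= t ->
  (forall k, 0 <= om k) -> (forall k, 0 <= rho k) -> (forall k, 0 <= c k) ->
  (forall k, (k < M)%N -> sumle om k * rho k `^ t <= B) ->
  sumge M (fun n => om n * sumge M (fun k => rho k * c k) n `^ t) 0 <=
  B * sumge M c 0 `^ t.
Proof.
move=> t1 om0 rho0 c0 hB; have t0 : 0 < t by apply: lt_le_trans t1.
set S := sumge M c 0; have S0 : 0 <= S by exact: sumge_ge0.
apply: (@le_trans _ _ (sumge M (fun n => sumge M (fun k =>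
    S `^ (t - 1) * om n * (rho k `^ t * c k)) n) 0)).
  apply: le_sumge => n _; rewrite sumgeZ.
  rewrite [S `^ _ * _]mulrC -mulrA ler_wpM2l//.
  apply: le_trans (jensen_sumge _ _ t1 rho0 c0) _; rewrite ler_wpM2r//.
    by apply: sumge_ge0 => k; rewrite mulr_ge0 ?powR_ge0.
  by rewrite ge0_ler_powR ?nnegrE ?sumge_ge0 ?subr_ge0 ?sumge_mono.
rewrite exchange_sumge_sumle.
apply: (@le_trans _ _ (sumge M (fun k => S `^ (t - 1) * B * c k) 0)).
  apply: le_sumge => k /andP[_ kM].
  rewrite (@eq_sumle _ _ (fun n => S `^ (t - 1) * (rho k `^ t * c k) * om n));
    last by move=> n _; ring.
  rewrite sumleZ -!mulrA ler_wpM2l ?powR_ge0// [leRHS]mulrC mulrCA.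
  by rewrite ler_wpM2l// mulrC hB.
rewrite sumgeZ -/S [S `^ _ * _]mulrC -mulrA [_ * S]mulrC mulr_powRB1//.
Qed.

End WeightedInequalities.

(** * Mirror images of the Hardy inequalities, and their converses *)

Section MirroredInequalities.
Context {R : realType}.
Implicit Types (c om rho kap eps : nat -> R) (M n k : nat) (t : R).

(** [hardy_sumge] for the reversed sequences. *)
Lemma hardy_sumle M om kap c t : 0 < t < 1 ->
  (forall k, 0 <= om k) -> (forall k, 0 <= kap k) -> (forall k, 0 <= c k) ->
  sumge M (fun n => om n * sumle (fun k => kap k * c k) n `^ t) 0 <=
  (1 - t)^-1 `^ t * 2 `^ (1 - t) * (sumge M c 0 `^ t *
   sumge M (fun n => sumge M om n `^ (t / (1 - t)) * om n *
              maxle (fun k => kap k `^ (t / (1 - t))) n) 0 `^ (1 - t)).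
Proof.
move=> t01 om0 kap0 c0.
have := @hardy_sumge R M (flip M om) (flip M kap) (flip M c) t t01
  (fun k => om0 _) (fun k => kap0 _) (fun k => c0 _).
rewrite sumge_flip; congr (_ <= _ * (_ * _ `^ _)).
  rewrite -[RHS]sumge_flip; apply: eq_sumge => n /andP[_ nM].
  by rewrite [RHS]/flip -sumge_flip_at.
rewrite -[RHS]sumge_flip; apply: eq_sumge => n /andP[_ nM].
by rewrite [RHS]/flip -maxge_flip// -sumle_flip.
Qed.

Lemma hardy_sumle_ge1 M om kap c B t : 1 <= t ->
  (forall k, 0 <= om k) -> (forall k, 0 <= kap k) -> (forall k, 0 <= c k) ->
  (forall k, (k < M)%N -> sumge M om k * kap k `^ t <= B) ->
  sumge M (fun n => om n * sumle (fun k => kap k * c k) n `^ t) 0 <=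
  B * sumge M c 0 `^ t.
Proof.
move=> t1 om0 kap0 c0 hB.
rewrite -(sumge_flip M c) -[leLHS]sumge_flip.
have H := @hardy_sumge_ge1 R M (flip M om) (flip M kap) (flip M c) B t t1
  (fun k => om0 _) (fun k => kap0 _) (fun k => c0 _).
apply: le_trans (H _); last by move=> k kM; rewrite sumle_flip// hB//; lia.
apply: le_sumge => n /andP[_ nM].
by rewrite [leLHS]/flip -sumge_flip_at.
Qed.

(* A step minorant of [P] that jumps only when [P] has doubled. *)
Fixpoint thin (P : nat -> R) n : R :=
  if n is m.+1 then (if 2 * thin P m < P n then P n else thin P m) else P 0%N.

Definition jump (P : nat -> R) n : bool :=
  if n is m.+1 then 2 * thin P m < P n else true.

Lemma thin_jump P n : jump P n -> thin P n = P n.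
Proof. by case: n => //= n ->. Qed.

Lemma thin_njump P n : ~~ jump P n.+1 -> thin P n.+1 = thin P n.
Proof. by move=> /= /negbTE->. Qed.

(** Between jumps the value is kept precisely because [P] has not exceeded twice of it. *)
Lemma thin_bounds P n : (forall k, 0 <= P k) ->
  {homo P : j k / (j <= k)%N >-> j <= k} ->
  thin P n <= P n /\ P n <= 2 * thin P n.
Proof.
move=> P0 Pmono; elim: n => [|n [ih1 ih2]] /=.
  by rewrite lexx mulr_natl mulr2n lerDl P0.
case: ltP => h; first by rewrite lexx mulr_natl mulr2n lerDl P0.
by split=> //; rewrite (le_trans ih1)// Pmono.
Qed.

Lemma thin_last_jump P n : exists2 k, (k <= n)%N & jump P k /\ thin P n = P k.
Proof.
elim: n => [|n [k kn [jk Pk]]]; first by exists 0%N.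
have [j|j] := boolP (jump P n.+1); first by exists n.+1; rewrite // thin_jump.
by exists k; rewrite ?thin_njump// (leq_trans kn).
Qed.

(** The hypothesis is tested with an [eps] supported on the jumps of [thin P]. With S' the sum to be
    estimated, [P] being replaced by [thin P], this gives S' <= C (const S')^t, which is solved for
    S'. *)
Lemma hardy_sumle_converse M om rho C t : 0 < t < 1 -> 0 <= C ->
  (forall k, 0 <= om k) -> (forall k, 0 <= rho k) ->
  (forall eps, (forall k, 0 <= eps k) ->
     sumge M (fun n => om n * maxle (fun k => rho k * eps k) n `^ t) 0 <=
     C * sumge M eps 0 `^ t) ->
  sumge M (fun n => sumge M om n `^ (t / (1 - t)) * om n *
             maxle (fun k => rho k `^ (t / (1 - t))) n) 0 <=
  2 * (2 * (1 + t / (1 - t))) `^ (t / (1 - t)) * C `^ (1 - t)^-1.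
Proof.
move=> t01 C0 om0 rho0 hC; have /andP[t0 t1] := t01.
have s0 : 0 < 1 - t by rewrite subr_gt0.
set g := t / (1 - t); have g0 : 0 < g by rewrite divr_gt0.
pose O := sumge M om; have O0 n : 0 <= O n by exact: sumge_ge0.
pose P := maxle (fun k => rho k `^ g).
have P0 n : 0 <= P n by exact: maxle_ge0.
have Pmono : {homo P : j k / (j <= k)%N >-> j <= k}.
  by move=> j k jk; exact: maxle_mono.
have thin0 n : 0 <= thin P n.
  have [k kn [_ ->]] := thin_last_jump P n; exact: P0.
(* At a jump the running maximum increases strictly, so it is attained at the index itself. *)
have jumpE k : jump P k -> P k = rho k `^ g.
  case: k => [_|k /= jk]; first by rewrite /P maxle0 ?powR_ge0.
  have [_ h] := thin_bounds k P0 Pmono.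
  have : P k < P k.+1 by apply: le_lt_trans jk.
  rewrite /P maxleS; have [//|h1] := leP (maxle (fun k => rho k `^ g) k) _.
  by rewrite ltxx.
pose eps k := if jump P k then O k `^ (1 + g) * P k else 0.
have eps0 k : 0 <= eps k by rewrite /eps; case: ifP; rewrite ?mulr_ge0 ?powR_ge0.
pose d k := if k is m.+1 then thin P k - thin P m else thin P 0.
have d0 k : 0 <= d k.
  case: k => [|k] /=; first exact: P0.
  rewrite subr_ge0; case: ltP => // /ltW; apply: le_trans.
  by rewrite mulr_natl mulr2n lerDl; exact: thin0.
have thinE n : thin P n = sumle d n.
  elim: n => [|n ih]; first by rewrite sumle0.
  by rewrite sumleS -ih /d addrC subrK.
(* At a jump P_k exceeds twice the previous value of [thin P], so P_k is at most twice the increment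
   [d k]. Without the doubling, the values of [P] could not be summed. *)
have eps_d k : eps k <= 2 * (O k `^ (1 + g) * d k).
  rewrite /eps; case: ifPn => jk; last by rewrite !mulr_ge0 ?powR_ge0.
  rewrite mulrCA ler_wpM2l ?powR_ge0//.
  case: k jk => [_|k jk]; first by rewrite /d/= mulr_natl mulr2n lerDl P0.
  by rewrite /d (thin_jump jk); move: jk => /=; lra.
(* The tails of [om] are head sums of the reversed sequence, so O_k^(1+g) telescopes with increments
   at most (1+g) O^g om, by convexity. *)
have O_pow k : (k < M)%N ->
    O k `^ (1 + g) <= (1 + g) * sumge M (fun n => O n `^ g * om n) k.
  move=> kM; have og0 j : 0 <= flip M om j by exact: om0.
  have := @sumle_increment_ge R (fun x => (1 + g) * x `^ g) (fun x => x `^ (1 + g))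
    (flip M om) (M - k.+1) og0.
  rewrite powR0 ?subr0 ?gt_eqF ?addr_gt0//.
  rewrite sumle_flip; last by lia.
  have -> : (M - (M - k.+1).+1 = k)%N by lia.
  move=> h; apply: le_trans (h _) _.
    move=> x y /andP[y0 yx].
    have := @subr_powR_le R x y (1 + g) (le_trans y0 yx) y0.
    by rewrite lerDl (ltW g0) addrAC subrr add0r; apply.
  rewrite -sumgeZ le_eqVlt; apply/orP; left; apply/eqP.
  rewrite -[X in sumge M _ X](_ : (M - (M - k.+1).+1)%N = k); last by lia.
  rewrite -sumle_flip; last by lia.
  apply: eq_sumle => j jk; rewrite -mulrA; congr (_ * _).
  by rewrite sumle_flip//; lia.
set S' := sumge M (fun n => O n `^ g * om n * thin P n) 0.
have S'0 : 0 <= S' by apply: sumge_ge0 => n; rewrite !mulr_ge0 ?powR_ge0.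
have sum_eps : sumge M eps 0 <= 2 * (1 + g) * S'.
  apply: (@le_trans _ _ (sumge M (fun k => 2 * (1 + g) *
      sumge M (fun n => O n `^ g * om n * d k) k) 0)).
    apply: le_sumge => k /andP[_ kM]; apply: le_trans (eps_d k) _.
    rewrite -mulrA ler_wpM2l//; apply: le_trans (ler_wpM2r (d0 k) (O_pow k kM)) _.
    by rewrite -mulrA /sumge mulr_suml.
  rewrite sumgeZ exchange_sumge_sumle ler_wpM2l ?mulr_ge0 ?addr_ge0 ?(ltW g0)//.
  by apply: le_sumge => n _; rewrite sumleZ -thinE.
(* For each n the maximum over k <= n is bounded below by its term at the last jump k. There (rho_k
   eps_k)^t = O_k^g P_k, because rho_k^t = P_k^(1-t) and (1+g) t = g, and O_k >= O_n. *)
have S'C : S' <= C * (2 * (1 + g) * S') `^ t.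
  apply: le_trans (le_trans (hC eps eps0) _); last first.
    rewrite ler_wpM2l// powR_le_iff// ?sumge_ge0//.
    by rewrite !mulr_ge0 ?addr_ge0 ?(ltW g0).
  apply: le_sumge => n /andP[_ nM]; rewrite -/(O n) mulrAC mulrC ler_wpM2l//.
  have [k kn [jk ->]] := thin_last_jump P n.
  have -> : O n `^ g * P k = O n `^ g * P k `^ (1 - t) * P k `^ t.
    rewrite -mulrA; congr (_ * _); have [->|Pk] := eqVneq (P k) 0.
      by rewrite powR0 ?gt_eqF// mul0r.
    by rewrite -powRD ?Pk ?implybT// subrK powRr1.
  have : rho k * eps k <= maxle (fun k => rho k * eps k) n.
    exact: (@maxle_ge_term _ (fun k => rho k * eps k)).
  rewrite -(@powR_le_iff _ _ _ t) ?maxle_ge0 ?mulr_ge0//; apply: le_trans.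
  rewrite /eps jk powRM ?mulr_ge0 ?powR_ge0// powRM ?powR_ge0// mulrCA mulrA.
  rewrite ler_wpM2r ?powR_ge0//.
  have -> : P k `^ (1 - t) = rho k `^ t.
    rewrite jumpE// -powRrM; congr (_ `^ _).
    by rewrite /g divfK ?gt_eqF.
  rewrite ler_wpM2r ?powR_ge0// -powRrM.
  have -> : (1 + g) * t = g by rewrite /g; field; rewrite gt_eqF.
  by rewrite powR_le_iff// sumge_mono.
(* The finite nonzero S'^t is divided out, and the root of order 1 - t is taken. *)
have key : S' <= (2 * (1 + g)) `^ g * C `^ (1 - t)^-1.
  have [->|S'neq0] := eqVneq S' 0; first by rewrite mulr_ge0 ?powR_ge0.
  have S'p : 0 < S' by rewrite lt_neqAle eq_sym S'neq0.
  have K0 : 0 <= 2 * (1 + g) by rewrite mulr_ge0 ?addr_ge0 ?(ltW g0).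
  rewrite -(@powR_le_iff _ _ _ (1 - t)) ?mulr_ge0 ?powR_ge0//.
  rewrite [leRHS]powRM ?powR_ge0// powRVK ?gt_eqF// -powRrM.
  have -> : g * (1 - t) = t by rewrite /g divfK ?gt_eqF.
  rewrite -(ler_pM2r (powR_gt0 t S'p)) -powRD ?S'neq0 ?implybT//.
  rewrite subrK powRr1//; apply: le_trans S'C _.
  by rewrite powRM// mulrA [C * _]mulrC.
(* The remaining factor 2 is the cost of returning from [thin P] to [P]. *)
rewrite -mulrA; apply: (@le_trans _ _ (2 * S')); last by rewrite ler_pM2l.
rewrite -sumgeZ; apply: le_sumge => n _; rewrite -/(O n) -/(P n) mulrCA.
rewrite ler_wpM2l ?mulr_ge0 ?powR_ge0//.
by have [] := thin_bounds n P0 Pmono.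
Qed.

Lemma hardy_sumge_converse M om rho C t : 0 < t < 1 -> 0 <= C ->
  (forall k, 0 <= om k) -> (forall k, 0 <= rho k) ->
  (forall eps, (forall k, 0 <= eps k) ->
     sumge M (fun n => om n * maxge M (fun k => rho k * eps k) n `^ t) 0 <=
     C * sumge M eps 0 `^ t) ->
  sumge M (fun n => sumle om n `^ (t / (1 - t)) * om n *
             maxge M (fun k => rho k `^ (t / (1 - t))) n) 0 <=
  2 * (2 * (1 + t / (1 - t))) `^ (t / (1 - t)) * C `^ (1 - t)^-1.
Proof.
move=> t01 C0 om0 rho0 hC.
have := @hardy_sumle_converse M (flip M om) (flip M rho) C t t01 C0
  (fun k => om0 _) (fun k => rho0 _).
move=> H; apply: le_trans (H _) => [|eps eps0].
  rewrite -[leLHS]sumge_flip; apply: le_sumge => n /andP[_ nM].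
  by rewrite [leLHS]/flip -maxle_flip// -sumge_flip_at.
apply: le_trans (le_trans (hC (flip M eps) (fun k => eps0 _)) _); last first.
  by rewrite sumge_flip.
rewrite -[leRHS]sumge_flip; apply: le_sumge => n /andP[_ nM].
rewrite [leRHS]/flip -maxle_flip//.
rewrite [leRHS](_ : _ = flip M om n * maxle (fun k => flip M rho k * eps k) n `^ t)//.
congr (_ * _ `^ _); apply: eq_maxle => k kn.
by rewrite -[eps k](flipK eps (leq_ltn_trans kn nM)).
Qed.

End MirroredInequalities.

(** * The operator on finite sequences *)

Section FiniteOperator.
Context {R : realType}.
Implicit Types (a c u v w kap rho eps : nat -> R) (M n k : nat) (p q : R).

(** The value before index 0 counts as 0, so that the head sums of the differences recover [a]. *)
Definition diff a k := if k is m.+1 then a k - a m else a 0%N.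

Lemma sumle_diff a n : sumle (diff a) n = a n.
Proof.
elim: n => [|n ih]; first by rewrite sumle0.
by rewrite sumleS ih /= addrC subrK.
Qed.

Lemma diff_ge0 a k : (forall k, 0 <= a k) ->
  {homo a : i j / (i <= j)%N >-> i <= j} -> 0 <= diff a k.
Proof. by move=> a0 am; case: k => //= k; rewrite subr_ge0 am. Qed.

Definition opT M u a n := maxge M (fun i => u i * sumle a i) n.

Lemma opT_ge0 M u a n : 0 <= opT M u a n.
Proof. exact: maxge_ge0. Qed.

(* With [lam k = v k `^ (1 / (1 - p))] the right-hand side is [\sum a^p v]; the
   second term on the left makes the induction go through. *)
Lemma hardy_diff a lam n p : 1 < p ->
  (forall k, 0 <= a k) -> (forall k, 0 < lam k) ->
  sumle (fun k => diff (fun k => sumle a k `^ p) k * sumle lam k `^ (1 - p)) n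
    + sumle a n `^ p * sumle lam n `^ (1 - p)
  <= 2 `^ p * sumle (fun k => a k `^ p * lam k `^ (1 - p)) n.
Proof.
move=> p1 a0 lam0; have p0 : 0 < p by apply: lt_trans p1.
have lam0' k : 0 <= lam k by exact: ltW.
have V0 k : 0 < sumle lam k.
  by apply: lt_le_trans (lam0 0%N) _; apply: sumle_ge_term.
elim: n => [|n ih].
  rewrite !sumle0 /= sumle0.
  have h2 : 2 <= 2 `^ p :> R by rewrite le1r_powR ?ler1n// ltW.
  have := ler_wpM2r (mulr_ge0 (powR_ge0 (a 0%N) p) (powR_ge0 (lam 0%N) (1 - p))) h2.
  lra.
rewrite [in leRHS]sumleS [X in X + _ <= _]sumleS mulrDr /diff.
set A := sumle a; set V := sumle lam.
(* In these ratios A^p V^(1-p) = V X^p and a^p lam^(1-p) = lam y^p; see [persp]. *)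
pose X := A n.+1 / V n.+1; pose y := a n.+1 / lam n.+1.
have A0 k : 0 <= A k by exact: sumle_ge0.
have X0 : 0 <= X by rewrite divr_ge0// ltW// V0.
have y0 : 0 <= y by rewrite divr_ge0.
have VE : V n = V n.+1 - lam n.+1 by rewrite /V sumleS addrK.
have AE : A n = A n.+1 - a n.+1 by rewrite /A sumleS addrK.
have persp (x l : R) : 0 <= x -> 0 < l -> x `^ p * l `^ (1 - p) = l * (x / l) `^ p.
  move=> x0 l0; rewrite powRM ?invr_ge0 ?(ltW l0)// -powR_inv1 ?(ltW l0)//.
  rewrite -powRrM mulN1r [RHS]mulrCA; congr (_ * _).
  by rewrite powRD ?(gt_eqF l0) ?implybT// powRr1// ltW.
(* The tangent inequality at X is used at the point 2 y because [step1] and [step2] each contribute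
   one copy of p X^(p-1) a. This is the origin of the constant 2^p. *)
have young : 2 * p * X `^ (p - 1) * y <= 2 `^ p * y `^ p + (p - 1) * X `^ p.
  have := @powR_tangent_ge R X (2 * y) p X0 (mulr_ge0 (ler0n _ 2) y0) (ltW p1).
  by rewrite powRM ?ler0n//; lra.
have mono : A n.+1 `^ p - A n `^ p <= p * A n.+1 `^ (p - 1) * a n.+1.
  have := @subr_powR_le R (A n.+1) (A n) p (A0 _) (A0 _) (ltW p1).
  by have -> : A n.+1 - A n = a n.+1 by [rewrite AE; ring].
have AX : A n.+1 `^ (p - 1) * V n.+1 `^ (1 - p) = X `^ (p - 1).
  rewrite /X powRM ?A0 ?invr_ge0 ?(ltW (V0 _))//; congr (_ * _).
  by rewrite -powR_inv1 ?(ltW (V0 _))// -powRrM; congr (_ `^ _); ring.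
have step1 : (A n.+1 `^ p - A n `^ p) * V n.+1 `^ (1 - p) <=
    p * X `^ (p - 1) * a n.+1.
  apply: le_trans (ler_wpM2r (powR_ge0 _ _) mono) _.
  by rewrite -AX; lra.
(* Convexity of the perspective function [(A, V) |-> A^p V^(1-p)]. *)
have step2 : A n.+1 `^ p * V n.+1 `^ (1 - p) - A n `^ p * V n `^ (1 - p) <=
    p * X `^ (p - 1) * a n.+1 - (p - 1) * X `^ p * lam n.+1.
  rewrite !persp ?A0 ?V0//; set Y := A n / V n; rewrite -/X.
  have Y0 : 0 <= Y by rewrite divr_ge0// ltW// V0.
  have h := ler_wpM2l (ltW (V0 n)) (@powR_tangent_ge R X Y p X0 Y0 (ltW p1)).
  have XX : X `^ p = X * X `^ (p - 1) by rewrite mulr_powRB1.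
  have XA : A n.+1 = X * V n.+1 by rewrite /X divfK// gt_eqF.
  have YA : A n = Y * V n by rewrite /Y divfK// gt_eqF.
  have aE : a n.+1 = X * V n.+1 - Y * V n by rewrite -XA -YA AE; ring.
  have lE : lam n.+1 = V n.+1 - V n by rewrite VE; ring.
  rewrite -/V in h; rewrite aE lE XX; rewrite XX in h.
  move: h; set Z := X `^ (p - 1); set W := Y `^ p; nra.
have fin : 2 * (p * X `^ (p - 1) * a n.+1) - (p - 1) * X `^ p * lam n.+1 <=
    2 `^ p * (a n.+1 `^ p * lam n.+1 `^ (1 - p)).
  rewrite persp// -/y.
  have -> : a n.+1 = lam n.+1 * y by rewrite /y mulrC divfK ?gt_eqF.
  have := ler_wpM2l (lam0' n.+1) young; lra.
move: ih step1 step2 fin; rewrite -/A -/V; lra.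
Qed.

(** Summation by parts for U^p A^p, with U the nonincreasing majorant of [u]: passing from i to i +
    1 adds at most U_(i+1)^p times the difference of A^p. *)
Lemma opT_powR_le M u a n p : 0 < p -> (n < M)%N ->
  (forall k, 0 <= u k) -> (forall k, 0 <= a k) ->
  opT M u a n `^ p <=
  maxge M u n `^ p * sumle a n `^ p +
  sumge M (fun k => maxge M u k `^ p * diff (fun k => sumle a k `^ p) k) n.
Proof.
move=> p0 nM u0 a0; set A := sumle a; set b := diff _; set U := maxge M u.
have A0 k : 0 <= A k by exact: sumle_ge0.
have U0 k : 0 <= U k by exact: maxge_ge0.
have b0 k : 0 <= b k.
  apply: diff_ge0 => [j|i j ij]; first exact: powR_ge0.
  by rewrite powR_le_iff// sumle_mono.
have S0 (m1 m2 : nat) : 0 <= \sum_(m1 <= k < m2) U k `^ p * b k.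
  by apply: sumr_ge0 => k _; rewrite mulr_ge0 ?powR_ge0.
rewrite /opT -maxge_powR// => [|k]; last by rewrite mulr_ge0// A0.
apply: maxge_le => [|i /andP[ni iM]].
  by rewrite addr_ge0 ?mulr_ge0 ?powR_ge0// S0.
apply: (@le_trans _ _ (U i `^ p * A i `^ p)).
  rewrite -powRM// powR_le_iff ?mulr_ge0// ler_wpM2r//.
  by apply: maxge_ge_term; rewrite leqnn.
rewrite /sumge (@big_cat_nat _ _ _ i.+1)//=; last exact: leqW.
rewrite addrA ler_wpDr//.
elim: i ni iM => [|i ih] ni iM.
  by move: ni; rewrite leqn0 => /eqP->; rewrite lerDl.
move: ni; rewrite leq_eqVlt => /predU1P[->|ni]; first by rewrite lerDl.
rewrite big_nat_recr ?leqW//= addrA.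
apply: le_trans (lerD (ih ni (ltnW iM)) (lexx _)).
have UU : U i.+1 `^ p <= U i `^ p by rewrite powR_le_iff// maxge_mono.
have := ler_wpM2r (powR_ge0 (A i) p) UU.
lra.
Qed.

(** Raising the previous bound to the power q/p splits the left-hand side into the two quantities
    controlled by [hardy_sumle] (weight U^q w) and [hardy_sumge] (weight w). *)
Lemma opT_sum_le M u a w kap rho c p q : 0 < p -> 0 < q ->
  (forall k, 0 <= u k) -> (forall k, 0 <= a k) -> (forall k, 0 <= w k) ->
  (forall k, (k < M)%N -> diff (fun k => sumle a k `^ p) k <= kap k * c k) ->
  (forall k, (k < M)%N ->
     maxge M u k `^ p * diff (fun k => sumle a k `^ p) k <= rho k * c k) ->
  sumge M (fun n => opT M u a n `^ q * w n) 0 <=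
  2 `^ (q / p) *
  (sumge M (fun n => maxge M u n `^ q * w n *
                     sumle (fun k => kap k * c k) n `^ (q / p)) 0 +
   sumge M (fun n => w n * sumge M (fun k => rho k * c k) n `^ (q / p)) 0).
Proof.
move=> p0 q0 u0 a0 w0 hkap hrho.
rewrite -sumgeD -sumgeZ; apply: le_sumge => n /andP[_ nM].
have t0 : 0 < q / p by rewrite divr_gt0.
have pq : p * (q / p) = q by rewrite mulrC divfK ?gt_eqF.
have b0 k : 0 <= diff (fun k => sumle a k `^ p) k.
  apply: diff_ge0 => [j|i j ij]; first exact: powR_ge0.
  by rewrite powR_le_iff ?sumle_ge0// sumle_mono.
have h1 : sumle a n `^ p <= sumle (fun k => kap k * c k) n.
  rewrite -(sumle_diff (fun k => sumle a k `^ p)).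
  by apply: le_sumle => k kn; rewrite hkap// (leq_ltn_trans kn).
have h2 : sumge M (fun k => maxge M u k `^ p * diff (fun k => sumle a k `^ p) k) n
    <= sumge M (fun k => rho k * c k) n.
  by apply: le_sumge => k /andP[_ kM]; rewrite hrho.
have k0 : 0 <= sumle (fun k => kap k * c k) n by apply: le_trans h1; exact: powR_ge0.
have r0 : 0 <= sumge M (fun k => rho k * c k) n.
  apply: le_trans h2; apply: sumge_ge0 => k.
  by rewrite mulr_ge0 ?powR_ge0.
have {}h : opT M u a n `^ q <= (maxge M u n `^ p * sumle (fun k => kap k * c k) n +
    sumge M (fun k => rho k * c k) n) `^ (q / p).
  rewrite -{1}pq powRrM powR_le_iff ?powR_ge0 ?addr_ge0 ?mulr_ge0 ?powR_ge0//.
  apply: le_trans (opT_powR_le p0 nM u0 a0) _.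
  by rewrite lerD// ler_wpM2l ?powR_ge0.
apply: le_trans (ler_wpM2r (w0 n) h) _.
have hh := @powR_addr_le R (maxge M u n `^ p * sumle (fun k => kap k * c k) n)
    (sumge M (fun k => rho k * c k) n) _ (mulr_ge0 (powR_ge0 _ _) k0) r0 t0.
apply: le_trans (ler_wpM2r (w0 n) hh) _.
rewrite [(maxge _ _ _ `^ p * _) `^ _]powRM ?powR_ge0// -powRrM pq.
by rewrite le_eqVlt; apply/orP; left; apply/eqP; ring.
Qed.

(** The supremum does not distinguish [u] from its majorant: for i >= k, u_i times the partial sum
    at k is at most u_i times the larger partial sum at i. *)
Lemma opT_ge M u a n k : (forall k, 0 <= a k) -> (n <= k < M)%N ->
  maxge M u k * sumle a k <= opT M u a n.
Proof.
move=> a0 /andP[nk kM]; have A0 j : 0 <= sumle a j by exact: sumle_ge0.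
have [->|Ak] := eqVneq (sumle a k) 0; first by rewrite mulr0 opT_ge0.
have {}Ak : 0 < sumle a k by rewrite lt_neqAle eq_sym Ak A0.
rewrite -ler_pdivlMr//; apply: maxge_le => [|i /andP[ki iM]].
  by rewrite divr_ge0// opT_ge0.
rewrite ler_pdivlMr//; have [ui|ui] := leP 0 (u i); last first.
  by apply: le_trans (opT_ge0 _ _ _ _); rewrite nmulr_rle0// A0.
apply: le_trans (ler_wpM2l ui (sumle_mono a0 ki)) _.
by apply: (@maxge_ge_term _ M (fun i => u i * sumle a i)); rewrite iM (leq_trans nk).
Qed.

End FiniteOperator.

(** * Upper bounds for finite sequences, and the construction of test sequences *)

Section FiniteEstimates.
Context {R : realType}.
Implicit Types (a c u v w kap rho eps : nat -> R) (M n k : nat) (p q : R).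

Definition finL M q u w a := sumge M (fun n => opT M u a n `^ q * w n) 0 `^ (1 / q).

Definition finN M p v a := sumge M (fun n => a n `^ p * v n) 0 `^ (1 / p).

(** This and [head_sum] are the sums on the right of [hardy_sumle] and [hardy_sumge] for t = q/p,
    where t/(1-t) = q/(p-q). *)
Definition tail_sum M p q u w kap :=
  sumge M (fun n =>
    sumge M (fun i => maxge M u i `^ q * w i) n `^ (q / (p - q))
    * (maxge M u n `^ q * w n) * maxle (fun k => kap k `^ (q / (p - q))) n) 0.

Definition head_sum M p q w rho :=
  sumge M (fun n => sumle w n `^ (q / (p - q)) * w n
    * maxge M (fun k => rho k `^ (q / (p - q))) n) 0.

Definition sup_bound M p q u w kap :=
  maxge M (fun n =>
    (maxge M u n `^ q * sumle w n
     + sumge M (fun i => maxge M u i `^ q * w i) n) `^ (1 / q)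
    * kap n `^ (1 / p)) 0.

(** All that the upper bounds use of [v]. The sequence [rho] is kept separate from U^p [kap] because
    for q < p <= 1 the head sum carries 1/v_k itself, not its running maximum. *)
Definition dominated M p u v kap rho K := forall a, (forall k, 0 <= a k) ->
  exists c, [/\ (forall k, 0 <= c k),
    (forall k, (k < M)%N -> diff (fun k => sumle a k `^ p) k <= kap k * c k),
    (forall k, (k < M)%N ->
      maxge M u k `^ p * diff (fun k => sumle a k `^ p) k <= rho k * c k) &
    sumge M c 0 <= K * sumge M (fun n => a n `^ p * v n) 0].

(** All that the lower bounds use of [v]. *)
Definition attained M p v kap := forall k, (k < M)%N ->
  exists a, [/\ (forall j, 0 <= a j),
    sumge M (fun n => a n `^ p * v n) 0 <= 1 & kap k <= sumle a k `^ p].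

Lemma ratioE p q : 0 < p -> q < p ->
  (q / p) / (1 - q / p) = q / (p - q).
Proof.
move=> p0 qp; have : p - q != 0 by rewrite subr_eq0 gt_eqF.
have : p != 0 by rewrite gt_eqF.
by move=> pn dn; field; rewrite pn dn.
Qed.

Lemma ratioVE p q : 0 < p -> 0 < q -> q / p * (1 / q) = 1 / p.
Proof. by move=> p0 q0; field; rewrite !gt_eqF. Qed.

Lemma exponentE p q : 0 < p -> 0 < q -> (1 - q / p) * (1 / q) = (p - q) / (p * q).
Proof. by move=> p0 q0; field; rewrite !gt_eqF. Qed.

Lemma ratio01 p q : 0 < p -> 0 < q -> q < p -> 0 < q / p < 1.
Proof. by move=> p0 q0 qp; rewrite divr_gt0// ltr_pdivrMr// mul1r. Qed.

Lemma sum_bounds_trans (X Y Z s h l K N x y : R) :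
  0 <= s -> 0 <= h -> 0 <= x -> 0 <= y ->
  X <= s * (Y + Z) -> Y <= h * (l * x) -> Z <= h * (l * y) -> l <= K * N ->
  X <= s * h * K * (x + y) * N.
Proof.
move=> s0 h0 x0 y0 hX hY hZ hl; apply: le_trans hX _.
have {}hl := ler_wpM2l (mulr_ge0 h0 (addr_ge0 x0 y0)) hl.
have -> : s * h * K * (x + y) * N = s * (h * (x + y) * (K * N)) by ring.
by rewrite ler_wpM2l//; lra.
Qed.

Lemma root_bound p q (D X N x y : R) : 0 < p -> 0 < q ->
  0 <= D -> 0 <= x -> 0 <= y -> 0 <= N -> 0 <= X ->
  X <= D * (x `^ (1 - q / p) + y `^ (1 - q / p)) * N `^ (q / p) ->
  X `^ (1 / q) <= (D * 2) `^ (1 / q) *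
    (x `^ ((p - q) / (p * q)) + y `^ ((p - q) / (p * q))) * N `^ (1 / p).
Proof.
move=> p0 q0 D0 x0 y0 N0 X0; have qV0 : 0 < 1 / q by rewrite divr_gt0.
set B := _ + _; have B0 : 0 <= B by rewrite addr_ge0 ?powR_ge0.
rewrite -(@powR_le_iff _ _ _ (1 / q)) ?mulr_ge0 ?powR_ge0//.
move=> h; apply: le_trans h _.
rewrite [leLHS]powRM ?powR_ge0 ?mulr_ge0// [X in X * _ <= _]powRM//.
have -> : (N `^ (q / p)) `^ (1 / q) = N `^ (1 / p).
  by rewrite -powRrM ratioVE.
rewrite ler_wpM2r ?powR_ge0// [X in _ <= X * _]powRM// -mulrA.
rewrite ler_wpM2l ?powR_ge0//.
apply: le_trans (powR_addr_le (powR_ge0 _ _) (powR_ge0 _ _) qV0) _.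
have e z : (z `^ (1 - q / p)) `^ (1 / q) = z `^ ((p - q) / (p * q)).
  by rewrite -powRrM exponentE.
by rewrite !e.
Qed.

Lemma root_bound1 p q (D X N G : R) : 0 < p -> 0 < q ->
  0 <= D -> 0 <= G -> 0 <= N -> 0 <= X ->
  X <= D * G `^ q * N `^ (q / p) ->
  X `^ (1 / q) <= D `^ (1 / q) * G * N `^ (1 / p).
Proof.
move=> p0 q0 D0 G0 N0 X0; have qV0 : 0 < 1 / q by rewrite divr_gt0.
rewrite -(@powR_le_iff _ _ _ (1 / q)) ?mulr_ge0 ?powR_ge0//.
move=> h; apply: le_trans h _.
rewrite powRM ?powR_ge0 ?mulr_ge0 ?powR_ge0// powRM ?powR_ge0//.
have -> : (G `^ q) `^ (1 / q) = G by rewrite div1r powRrK ?gt_eqF.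
by rewrite -powRrM ratioVE.
Qed.

(** [opT_sum_le] splits the sum, the Hardy inequalities with t = q/p < 1 bound both parts, and
    [root_bound] extracts the q-th root. *)
Lemma finL_le_sum M p q u v w kap rho K a : 0 < p -> 0 < q -> q < p -> 0 <= K ->
  (forall k, 0 <= u k) -> (forall k, 0 <= v k) -> (forall k, 0 <= w k) ->
  (forall k, 0 <= a k) -> (forall k, 0 <= kap k) -> (forall k, 0 <= rho k) ->
  dominated M p u v kap rho K ->
  finL M q u w a <=
  (2 `^ (q / p) * ((1 - q / p)^-1 `^ (q / p) * 2 `^ (1 - q / p)) * K `^ (q / p) * 2)
    `^ (1 / q)
  * (tail_sum M p q u w kap `^ ((p - q) / (p * q)) +
     head_sum M p q w rho `^ ((p - q) / (p * q))) * finN M p v a.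
Proof.
move=> p0 q0 qp K0 u0 v0 w0 a0 kap0 rho0 /(_ a a0)[c [c0 hkap hrho hc]].
have t01 := ratio01 p0 q0 qp; have /andP[t0 t1] := t01.
have qV0 : 0 < 1 / q by rewrite divr_gt0.
set L := sumge M c 0 in hc; have L0 : 0 <= L by exact: sumge_ge0.
have Uw0 n : 0 <= maxge M u n `^ q * w n by rewrite mulr_ge0 ?powR_ge0.
have := @hardy_sumle R M (fun n => maxge M u n `^ q * w n) kap c _ t01 Uw0 kap0 c0.
have := @hardy_sumge R M w rho c _ t01 w0 rho0 c0.
rewrite ratioE// -/(tail_sum M p q u w kap) -/(head_sum M p q w rho) -/L.
have := opT_sum_le p0 q0 u0 a0 w0 hkap hrho.
set X := sumge _ _ _; set Y := sumge _ _ _; set Z := sumge _ _ _.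
set A1 := tail_sum _ _ _ _ _ _; set A2 := head_sum _ _ _ _ _.
have A1_0 : 0 <= A1.
  by apply: sumge_ge0 => n; rewrite !mulr_ge0 ?powR_ge0 ?maxle_ge0.
have A2_0 : 0 <= A2.
  by apply: sumge_ge0 => n; rewrite !mulr_ge0 ?powR_ge0 ?maxge_ge0.
set N := sumge M (fun n => a n `^ p * v n) 0 in hc *.
have N0 : 0 <= N by apply: sumge_ge0 => n; rewrite mulr_ge0 ?powR_ge0.
have X0 : 0 <= X by apply: sumge_ge0 => n; rewrite mulr_ge0 ?powR_ge0.
have Lt : L `^ (q / p) <= K `^ (q / p) * N `^ (q / p).
  by rewrite -powRM// powR_le_iff// mulr_ge0.
set H := _ * 2 `^ (1 - q / p); have H0 : 0 <= H by rewrite mulr_ge0 ?powR_ge0.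
move=> hX hZ hY.
pose B := A1 `^ (1 - q / p) + A2 `^ (1 - q / p).
have B0 : 0 <= B by rewrite addr_ge0 ?powR_ge0.
pose D := 2 `^ (q / p) * H * K `^ (q / p); have D0 : 0 <= D.
  by rewrite !mulr_ge0 ?powR_ge0.
have XB : X <= D * B * N `^ (q / p).
  exact: (sum_bounds_trans (powR_ge0 _ _) H0 (powR_ge0 _ _) (powR_ge0 _ _)
    hX hY hZ Lt).
exact: (root_bound p0 q0 D0 A1_0 A2_0 N0 X0 XB).
Qed.

Lemma finL_le_sup M p q u v w kap K a : 0 < p -> p <= q -> 0 <= K ->
  (forall k, 0 <= u k) -> (forall k, 0 <= v k) -> (forall k, 0 <= w k) ->
  (forall k, 0 <= a k) -> (forall k, 0 <= kap k) ->
  dominated M p u v kap (fun k => maxge M u k `^ p * kap k) K ->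
  finL M q u w a <=
  (2 `^ (q / p) * 2 * K `^ (q / p)) `^ (1 / q) * sup_bound M p q u w kap
    * finN M p v a.
Proof.
move=> p0 pq K0 u0 v0 w0 a0 kap0 /(_ a a0)[c [c0 hkap hrho hc]].
have q0 : 0 < q by exact: lt_le_trans pq.
have t1 : 1 <= q / p by rewrite ler_pdivlMr// mul1r.
have t0 : 0 < q / p by rewrite divr_gt0.
have qV0 : 0 < 1 / q by rewrite divr_gt0.
set L := sumge M c 0 in hc; have L0 : 0 <= L by exact: sumge_ge0.
have Uw0 n : 0 <= maxge M u n `^ q * w n by rewrite mulr_ge0 ?powR_ge0.
set G := sup_bound _ _ _ _ _ _; have G0 : 0 <= G by exact: maxge_ge0.
(* G^q bounds the two summands together, hence each of them; these are the constants required by the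
   Hardy inequalities for q/p >= 1. *)
have hG k : (k < M)%N -> (maxge M u k `^ q * sumle w k
     + sumge M (fun i => maxge M u i `^ q * w i) k) * kap k `^ (q / p) <= G `^ q.
  move=> kM; have W0 : 0 <= sumle w k by exact: sumle_ge0.
  have T0 : 0 <= sumge M (fun i => maxge M u i `^ q * w i) k by exact: sumge_ge0.
  have S0 : 0 <= maxge M u k `^ q * sumle w k
     + sumge M (fun i => maxge M u i `^ q * w i) k.
    by rewrite addr_ge0 ?mulr_ge0 ?powR_ge0.
  have := @maxge_ge_term _ M (fun n =>
    (maxge M u n `^ q * sumle w n
     + sumge M (fun i => maxge M u i `^ q * w i) n) `^ (1 / q)
    * kap n `^ (1 / p)) 0 k kM.
  rewrite -/(sup_bound M p q u w kap) -/G.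
  rewrite -(@powR_le_iff _ _ _ q) ?mulr_ge0 ?powR_ge0//.
  rewrite powRM ?powR_ge0// div1r powRVK ?gt_eqF// -powRrM.
  by have -> : 1 / p * q = q / p by rewrite mulrC mulrA mulr1.
have hG1 k : (k < M)%N ->
    sumge M (fun n => maxge M u n `^ q * w n) k * kap k `^ (q / p) <= G `^ q.
  move=> kM; apply: le_trans (hG k kM); rewrite ler_wpM2r ?powR_ge0//.
  by rewrite lerDr mulr_ge0 ?powR_ge0 ?sumle_ge0.
have hG2 k : (k < M)%N ->
    sumle w k * (maxge M u k `^ p * kap k) `^ (q / p) <= G `^ q.
  move=> kM; apply: le_trans (hG k kM).
  rewrite powRM ?powR_ge0// -powRrM; have -> : p * (q / p) = q.
    by rewrite mulrC divfK// gt_eqF.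
  rewrite mulrA ler_wpM2r ?powR_ge0// mulrC lerDl.
  exact: sumge_ge0.
have rho0 k : 0 <= maxge M u k `^ p * kap k by rewrite mulr_ge0 ?powR_ge0.
have := hardy_sumle_ge1 t1 Uw0 kap0 c0 hG1.
have := hardy_sumge_ge1 t1 w0 rho0 c0 hG2.
have := opT_sum_le p0 q0 u0 a0 w0 hkap hrho; rewrite -/L.
set X := sumge _ _ _; set Y := sumge _ _ _; set Z := sumge _ _ _.
set N := sumge M (fun n => a n `^ p * v n) 0 in hc *.
have N0 : 0 <= N by apply: sumge_ge0 => n; rewrite mulr_ge0 ?powR_ge0.
have X0 : 0 <= X by apply: sumge_ge0 => n; rewrite mulr_ge0 ?powR_ge0.
have Lt : L `^ (q / p) <= K `^ (q / p) * N `^ (q / p).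
  by rewrite -powRM// powR_le_iff// mulr_ge0.
move=> hX hZ hY.
pose D := 2 `^ (q / p) * 2 * K `^ (q / p).
have D0 : 0 <= D by rewrite !mulr_ge0 ?powR_ge0.
have XB : X <= D * G `^ q * N `^ (q / p).
  have hY' : Y <= G `^ q * (L `^ (q / p) * 1) by rewrite mulr1.
  have hZ' : Z <= G `^ q * (L `^ (q / p) * 1) by rewrite mulr1.
  have := sum_bounds_trans (powR_ge0 2 (q / p)) (powR_ge0 G q) ler01 ler01
    hX hY' hZ' Lt.
  by have -> (s g k n : R) : s * g * k * (1 + 1) * n = s * 2 * k * g * n by ring.
exact: (root_bound1 p0 q0 D0 G0 N0 X0 XB).
Qed.

(** The witness is the pointwise maximum of the extremal sequences scaled by eps_k^(1/p). Its p-th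
    power is at most the sum of the p-th powers, and it dominates each member of the family. *)
Lemma attained_family M p v kap eps : 0 < p -> (forall k, 0 <= v k) ->
  attained M p v kap -> (forall k, 0 <= eps k) ->
  exists a, [/\ (forall j, 0 <= a j),
    sumge M (fun n => a n `^ p * v n) 0 <= sumge M eps 0 &
    forall k, (k < M)%N -> kap k * eps k <= sumle a k `^ p].
Proof.
move=> p0 v0 hk eps0; have pV0 : 0 < 1 / p by rewrite divr_gt0.
have /choice[x hx] : forall k, exists a, (forall j, 0 <= a j) /\ ((k < M)%N ->
    sumge M (fun n => a n `^ p * v n) 0 <= 1 /\ kap k <= sumle a k `^ p).
  move=> k; have [kM|Mk] := ltnP k M; last by exists (fun=> 0).
  by have [a [? ? ?]] := hk k kM; exists a.
have x0 k j : 0 <= x k j by case: (hx k).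
have y0 k j : 0 <= eps k `^ (1 / p) * x k j by rewrite mulr_ge0 ?powR_ge0.
exists (fun j => maxge M (fun k => eps k `^ (1 / p) * x k j) 0); split.
- by move=> j; exact: maxge_ge0.
- apply: (@le_trans _ _ (sumge M (fun n => sumge M (fun k =>
    eps k * (x k n `^ p * v n)) 0) 0)).
    apply: le_sumge => n _; rewrite -maxge_powR//.
    rewrite (_ : sumge _ _ _ = sumge M (fun k => eps k * x k n `^ p) 0 * v n);
      last by rewrite /sumge mulr_suml; apply: eq_bigr => k _; rewrite mulrA.
    rewrite ler_wpM2r//; apply: maxge_le => [|k kM].
      by apply: sumge_ge0 => k; rewrite mulr_ge0 ?powR_ge0.
    rewrite powRM ?powR_ge0// div1r powRVK ?gt_eqF//.
    by apply: (@sumge_ge_term _ M (fun k => eps k * x k n `^ p)) => // j;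
      rewrite mulr_ge0 ?powR_ge0.
  rewrite /sumge exchange_big/=; apply: le_sumge => k /andP[_ kM].
  rewrite -mulr_sumr -[leRHS]mulr1 ler_wpM2l//.
  by have [_ /(_ kM)[]] := hx k.
- move=> k kM; have [_ /(_ kM)[_ hkap]] := hx k.
  apply: (@le_trans _ _ ((eps k `^ (1 / p) * sumle (x k) k) `^ p)).
    rewrite powRM ?powR_ge0 ?sumle_ge0// div1r powRVK ?gt_eqF//.
    by rewrite mulrC ler_wpM2l.
  rewrite powR_le_iff ?mulr_ge0 ?powR_ge0 ?sumle_ge0//; last first.
    by move=> j; exact: maxge_ge0.
  rewrite -sumleZ; apply: le_sumle => j _.
  exact: (@maxge_ge_term _ M (fun k => eps k `^ (1 / p) * x k j)).
Qed.

End FiniteEstimates.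

(** * Lower bounds for finite sequences *)

Section FiniteLowerBounds.
Context {R : realType}.
Implicit Types (a c u v w kap rho eps : nat -> R) (M n k : nat) (p q C : R).

Lemma finL_le_powR M p q u v w C a : 0 < p -> 0 < q -> 0 <= C ->
  (forall k, 0 <= v k) -> (forall k, 0 <= w k) ->
  finL M q u w a <= C * finN M p v a ->
  sumge M (fun n => opT M u a n `^ q * w n) 0 <=
  C `^ q * sumge M (fun n => a n `^ p * v n) 0 `^ (q / p).
Proof.
move=> p0 q0 C0 v0 w0.
have X0 : 0 <= sumge M (fun n => opT M u a n `^ q * w n) 0.
  by apply: sumge_ge0 => n; rewrite mulr_ge0 ?powR_ge0.
rewrite -(@powR_le_iff _ _ _ q) ?mulr_ge0 ?powR_ge0//.
rewrite /finL /finN div1r powRVK ?gt_eqF// powRM ?powR_ge0// -powRrM.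
by have -> : 1 / p * q = q / p by rewrite mulrC mulrA mulr1.
Qed.

(** The converse Hardy inequality with weight U^q w. Its hypothesis is verified on the sequences of
    [attained_family], using only the value U_n A_n in the supremum defining the operator at n. *)
Lemma tail_sum_le M p q u v w kap C : 0 < p -> 0 < q -> q < p -> 0 <= C ->
  (forall k, 0 <= u k) -> (forall k, 0 <= v k) -> (forall k, 0 <= w k) ->
  (forall k, 0 <= kap k) -> attained M p v kap ->
  (forall a, (forall k, 0 <= a k) -> finL M q u w a <= C * finN M p v a) ->
  tail_sum M p q u w kap `^ ((p - q) / (p * q)) <=
  (2 * (2 * (1 + q / (p - q))) `^ (q / (p - q))) `^ ((p - q) / (p * q)) * C.
Proof.
move=> p0 q0 qp C0 u0 v0 w0 kap0 hk hC.
have t01 := ratio01 p0 q0 qp; have /andP[t0 t1] := t01.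
have Uw0 n : 0 <= maxge M u n `^ q * w n by rewrite mulr_ge0 ?powR_ge0.
have pq0 : 0 < p - q by rewrite subr_gt0.
have r0 : 0 < (p - q) / (p * q) by rewrite divr_gt0 ?mulr_gt0.
have := @hardy_sumle_converse R M (fun n => maxge M u n `^ q * w n) kap
  (C `^ q) _ t01 (powR_ge0 _ _) Uw0 kap0.
rewrite ratioE// -/(tail_sum M p q u w kap) => H.
have {}H : tail_sum M p q u w kap <=
   2 * (2 * (1 + q / (p - q))) `^ (q / (p - q)) * (C `^ q) `^ (1 - q / p)^-1.
  apply: H => eps eps0; have [a [a0 aeps akap]] := attained_family p0 v0 hk eps0.
  apply: le_trans (le_trans (finL_le_powR p0 q0 C0 v0 w0 (hC a a0)) _); last first.
    rewrite ler_wpM2l ?powR_ge0// powR_le_iff ?sumge_ge0// => k.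
    by rewrite mulr_ge0 ?powR_ge0.
  apply: le_sumge => n /andP[_ nM]; rewrite mulrAC ler_wpM2r//.
  apply: (@le_trans _ _ ((maxge M u n * sumle a n) `^ q)); last first.
    rewrite powR_le_iff ?opT_ge0 ?mulr_ge0 ?maxge_ge0 ?sumle_ge0//.
    by apply: opT_ge; rewrite ?leqnn.
  rewrite powRM ?maxge_ge0 ?sumle_ge0// ler_wpM2l ?powR_ge0//.
  have -> : sumle a n `^ q = (sumle a n `^ p) `^ (q / p).
    by rewrite -powRrM mulrC divfK ?gt_eqF.
  rewrite powR_le_iff ?maxle_ge0 ?powR_ge0//; apply: maxle_le => [|k kn].
    exact: powR_ge0.
  apply: le_trans (akap k (leq_ltn_trans kn nM)) _.
  by rewrite powR_le_iff ?sumle_ge0// sumle_mono.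
have T0 : 0 <= tail_sum M p q u w kap.
  by apply: sumge_ge0 => n; rewrite !mulr_ge0 ?powR_ge0 ?maxle_ge0.
have K0 : 0 <= 2 * (2 * (1 + q / (p - q))) `^ (q / (p - q)).
  by rewrite mulr_ge0 ?powR_ge0.
rewrite -(powR_le_iff T0 _ r0) ?mulr_ge0 ?powR_ge0// in H.
apply: le_trans H _; rewrite powRM ?powR_ge0// -!powRrM.
have -> : q * ((1 - q / p)^-1 * ((p - q) / (p * q))) = 1.
  by field; rewrite !gt_eqF.
by rewrite powRr1.
Qed.

(** As for the tail sum, but with weight w and using all the values U_k A_k with k >= n. *)
Lemma head_sum_le M p q u v w kap C : 0 < p -> 0 < q -> q < p -> 0 <= C ->
  (forall k, 0 <= u k) -> (forall k, 0 <= v k) -> (forall k, 0 <= w k) ->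
  (forall k, 0 <= kap k) -> attained M p v kap ->
  (forall a, (forall k, 0 <= a k) -> finL M q u w a <= C * finN M p v a) ->
  head_sum M p q w (fun k => maxge M u k `^ p * kap k) `^ ((p - q) / (p * q)) <=
  (2 * (2 * (1 + q / (p - q))) `^ (q / (p - q))) `^ ((p - q) / (p * q)) * C.
Proof.
move=> p0 q0 qp C0 u0 v0 w0 kap0 hk hC.
have t01 := ratio01 p0 q0 qp; have /andP[t0 t1] := t01.
have pq0 : 0 < p - q by rewrite subr_gt0.
have r0 : 0 < (p - q) / (p * q) by rewrite divr_gt0 ?mulr_gt0.
set rho := fun k => _; have rho0 k : 0 <= rho k by rewrite mulr_ge0 ?powR_ge0.
have := @hardy_sumge_converse R M w rho (C `^ q) _ t01 (powR_ge0 _ _) w0 rho0.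
rewrite ratioE// -/(head_sum M p q w rho) => H.
have {}H : head_sum M p q w rho <=
   2 * (2 * (1 + q / (p - q))) `^ (q / (p - q)) * (C `^ q) `^ (1 - q / p)^-1.
  apply: H => eps eps0; have [a [a0 aeps akap]] := attained_family p0 v0 hk eps0.
  apply: le_trans (le_trans (finL_le_powR p0 q0 C0 v0 w0 (hC a a0)) _); last first.
    rewrite ler_wpM2l ?powR_ge0// powR_le_iff ?sumge_ge0// => k.
    by rewrite mulr_ge0 ?powR_ge0.
  apply: le_sumge => n /andP[_ nM]; rewrite mulrC ler_wpM2r//.
  have -> : opT M u a n `^ q = (opT M u a n `^ p) `^ (q / p).
    by rewrite -powRrM mulrC divfK ?gt_eqF.
  rewrite powR_le_iff ?maxge_ge0 ?powR_ge0//.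
  apply: maxge_le => [|k /andP[nk kM]]; first exact: powR_ge0.
  apply: (@le_trans _ _ ((maxge M u k * sumle a k) `^ p)).
    rewrite powRM ?maxge_ge0 ?sumle_ge0// /rho -mulrA ler_wpM2l ?powR_ge0//.
    exact: akap.
  rewrite powR_le_iff ?opT_ge0 ?mulr_ge0 ?maxge_ge0 ?sumle_ge0//.
  by apply: opT_ge; rewrite ?nk.
have T0 : 0 <= head_sum M p q w rho.
  by apply: sumge_ge0 => n; rewrite !mulr_ge0 ?powR_ge0 ?maxge_ge0 ?sumle_ge0.
have K0 : 0 <= 2 * (2 * (1 + q / (p - q))) `^ (q / (p - q)).
  by rewrite mulr_ge0 ?powR_ge0.
rewrite -(powR_le_iff T0 _ r0) ?mulr_ge0 ?powR_ge0// in H.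
apply: le_trans H _; rewrite powRM ?powR_ge0// -!powRrM.
have -> : q * ((1 - q / p)^-1 * ((p - q) / (p * q))) = 1.
  by field; rewrite !gt_eqF.
by rewrite powRr1.
Qed.

(** A single extremal sequence for [kap n] suffices. The terms k <= n, where the operator is at
    least U_n A_n, give the head part; the terms k >= n, where it is at least U_k A_n, give the tail
    part. Having two parts costs 2^(1/q). *)
Lemma sup_bound_le M p q u v w kap C : 0 < p -> 0 < q -> 0 <= C ->
  (forall k, 0 <= u k) -> (forall k, 0 <= v k) -> (forall k, 0 <= w k) ->
  (forall k, 0 <= kap k) -> attained M p v kap ->
  (forall a, (forall k, 0 <= a k) -> finL M q u w a <= C * finN M p v a) ->
  sup_bound M p q u w kap <= 2 `^ (1 / q) * C.
Proof.
move=> p0 q0 C0 u0 v0 w0 kap0 hk hC.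
apply: maxge_le => [|n /andP[_ nM]]; first by rewrite mulr_ge0 ?powR_ge0.
have [a [a0 aN akap]] := hk n nM.
have := finL_le_powR p0 q0 C0 v0 w0 (hC a a0).
set X := sumge _ _ _; set N := sumge _ _ _ in aN *.
have N0 : 0 <= N by apply: sumge_ge0 => k; rewrite mulr_ge0 ?powR_ge0.
have U0 k : 0 <= maxge M u k by exact: maxge_ge0.
have t0 : 0 < q / p by rewrite divr_gt0.
have XC : X <= C `^ q -> maxge M u n `^ q * sumle w n * kap n `^ (q / p) <= C `^ q.
  apply: le_trans; rewrite mulrAC -sumleZ.
  apply: (@le_trans _ _ (sumle (fun k => opT M u a k `^ q * w k) n)).
    apply: le_sumle => k kn; rewrite ler_wpM2r//.
    apply: (@le_trans _ _ ((maxge M u n * sumle a n) `^ q)).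
      rewrite powRM ?sumle_ge0// ler_wpM2l ?powR_ge0//.
      have -> : sumle a n `^ q = (sumle a n `^ p) `^ (q / p).
        by rewrite -powRrM mulrC divfK ?gt_eqF.
      by rewrite powR_le_iff ?powR_ge0.
    rewrite powR_le_iff ?opT_ge0 ?mulr_ge0 ?sumle_ge0//.
    by apply: opT_ge; rewrite ?kn.
  rewrite /X /sumge /sumle (@big_cat_nat _ _ _ n.+1 0 M)//= lerDl sumr_ge0// => k _.
  by rewrite mulr_ge0 ?powR_ge0.
have XC' : X <= C `^ q ->
    sumge M (fun i => maxge M u i `^ q * w i) n * kap n `^ (q / p) <= C `^ q.
  apply: le_trans; rewrite mulrC -sumgeZ.
  apply: (@le_trans _ _ (sumge M (fun k => opT M u a k `^ q * w k) n)).
    apply: le_sumge => k /andP[nk kM]; rewrite mulrA ler_wpM2r//.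
    apply: (@le_trans _ _ ((maxge M u k * sumle a k) `^ q)).
      rewrite powRM ?sumle_ge0// mulrC ler_wpM2l ?powR_ge0//.
      have -> : sumle a k `^ q = (sumle a k `^ p) `^ (q / p).
        by rewrite -powRrM mulrC divfK ?gt_eqF.
      rewrite powR_le_iff ?powR_ge0//; apply: le_trans akap _.
      by rewrite powR_le_iff ?sumle_ge0// sumle_mono.
    rewrite powR_le_iff ?opT_ge0 ?mulr_ge0 ?sumle_ge0//.
    by apply: opT_ge; rewrite ?leqnn.
  by apply: sumge_mono => // k; rewrite mulr_ge0 ?powR_ge0.
move=> hX; have {hX} XC1 : X <= C `^ q.
  apply: le_trans hX _; rewrite -[leRHS]mulr1 ler_wpM2l ?powR_ge0//.
  have : N `^ (q / p) <= 1 `^ (q / p) by rewrite powR_le_iff.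
  by rewrite powR1.
have S0 : 0 <= maxge M u n `^ q * sumle w n +
    sumge M (fun i => maxge M u i `^ q * w i) n.
  by rewrite addr_ge0 ?mulr_ge0 ?powR_ge0 ?sumle_ge0 ?sumge_ge0// => k;
    rewrite mulr_ge0 ?powR_ge0.
rewrite -(@powR_le_iff _ _ _ q) ?mulr_ge0 ?powR_ge0//.
rewrite powRM ?powR_ge0// div1r powRVK ?gt_eqF// -powRrM.
rewrite [leRHS]powRM ?powR_ge0// powRVK ?gt_eqF//.
have -> : 1 / p * q = q / p by rewrite mulrC mulrA mulr1.
by rewrite mulrDl mulr_natl mulr2n lerD// ?XC ?XC'.
Qed.

End FiniteLowerBounds.

(** * The dual weights for p > 1 and p <= 1 *)

Section FiniteCases.
Context {R : realType}.
Implicit Types (a c u v w kap rho eps : nat -> R) (M n k : nat) (p q C : R).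

Definition dual_sum p v n := sumle (fun k => v k `^ (1 / (1 - p))) n.

Lemma dual_sum_gt0 p v n : (forall k, 0 < v k) -> 0 < dual_sum p v n.
Proof.
move=> v0; apply: lt_le_trans (powR_gt0 (1 / (1 - p)) (v0 0%N)) _.
apply: (@sumle_ge_term _ (fun k => v k `^ (1 / (1 - p)))) => // k.
exact: powR_ge0.
Qed.

Lemma dual_weightK p v k : 1 < p -> (forall k, 0 < v k) ->
  (v k `^ (1 / (1 - p))) `^ (1 - p) = v k.
Proof.
move=> p1 v0; rewrite div1r powRVK ?(ltW (v0 k))//.
by rewrite subr_eq0 lt_eqF.
Qed.

(** Here c is the difference of A^p times V^(1-p), with V the dual sum, and [hardy_diff] bounds its
    total. *)
Lemma dominated_gt1 M p u v : 1 < p -> (forall k, 0 < v k) ->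
  dominated M p u v (fun n => dual_sum p v n `^ (p - 1))
    (fun n => maxge M u n `^ p * dual_sum p v n `^ (p - 1)) (2 `^ p).
Proof.
move=> p1 v0 a a0; have V0 := dual_sum_gt0 p _ v0.
have p0 : 0 < p by apply: lt_trans p1.
set b := diff _; have b0 k : 0 <= b k.
  apply: diff_ge0 => [j|i j ij]; first exact: powR_ge0.
  by rewrite powR_le_iff ?sumle_ge0// sumle_mono.
have bE k : dual_sum p v k `^ (p - 1) * (b k * dual_sum p v k `^ (1 - p)) = b k.
  rewrite mulrCA -powRD ?(gt_eqF (V0 k)) ?implybT//.
  by have -> : p - 1 + (1 - p) = 0 by [ring]; rewrite powRr0 mulr1.
exists (fun k => b k * dual_sum p v k `^ (1 - p)); split.
- by move=> k; rewrite mulr_ge0 ?powR_ge0.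
- by move=> k _; rewrite bE.
- by move=> k _; rewrite -mulrA bE.
- case: M => [|M].
    by rewrite /sumge !big_geq// mulr0.
  have lam0 k : 0 < v k `^ (1 / (1 - p)) by rewrite powR_gt0.
  have := hardy_diff M p1 a0 lam0.
  have : 0 <= sumle a M `^ p * dual_sum p v M `^ (1 - p).
    by rewrite mulr_ge0 ?powR_ge0.
  under [X in _ -> _ <= _ * X -> _]eq_sumle do rewrite dual_weightK//.
  rewrite -/(dual_sum p v M) => h1 h2; apply: le_trans h2.
  by rewrite -[leLHS]addr0 lerD.
Qed.

(** The equality case of Hoelder's inequality on j <= k: a_j = v_j^(1/(1-p)) V_k^(-1/p). *)
Lemma attained_gt1 M p v : 1 < p -> (forall k, 0 < v k) ->
  attained M p v (fun n => dual_sum p v n `^ (p - 1)).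
Proof.
move=> p1 v0 k kM; have V0 := dual_sum_gt0 p k v0.
have p0 : 0 < p by apply: lt_trans p1.
pose lam j := v j `^ (1 / (1 - p)).
pose a j := if (j <= k)%N then lam j * dual_sum p v k `^ (- (1 / p)) else 0.
exists a; split.
- by move=> j; rewrite /a; case: ifP => // _; rewrite mulr_ge0 ?powR_ge0.
- rewrite /sumge (@big_cat_nat _ _ _ k.+1)//= [X in _ + X]big1_seq; last first.
    move=> j /andP[_]; rewrite mem_index_iota => /andP[kj _].
    by rewrite /a leqNgt kj/= powR0 ?gt_eqF// mul0r.
  rewrite addr0 (_ : \sum_(_ <= _ < _) _ = (dual_sum p v k)^-1 * dual_sum p v k).
    by rewrite mulVf ?gt_eqF.
  rewrite -/(sumle _ k) -sumleZ; apply: eq_sumle => j jk.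
  rewrite /a jk powRM ?powR_ge0// -powRrM mulNr mulrC mulrA.
  rewrite div1r mulVf ?gt_eqF// powR_inv1 ?(ltW V0)// mulrC; congr (_ * _).
  rewrite /lam -[X in X * _](powRr1 (ltW (v0 j))) -powRrM -powRD; last first.
    by rewrite (gt_eqF (v0 j)) implybT.
  congr (_ `^ _); field.
  by rewrite subr_eq0 lt_eqF.
- rewrite (@eq_sumle _ _ (fun j => dual_sum p v k `^ (- (1 / p)) * lam j)); last first.
    by move=> j jk; rewrite /a jk mulrC.
  rewrite sumleZ -/(dual_sum p v k) -[X in _ * X](powRr1 (ltW V0)).
  rewrite -powRD; last by rewrite (gt_eqF V0) implybT.
  rewrite -powRrM le_eqVlt; apply/orP; left; apply/eqP; congr (_ `^ _).
  by field; rewrite gt_eqF.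
Qed.

Definition maxle_inv v n := maxle (fun k => (v k)^-1) n.

(** Subadditivity of the p-th power for p <= 1. *)
Lemma diff_powR_le a k p : 0 < p <= 1 -> (forall k, 0 <= a k) ->
  diff (fun k => sumle a k `^ p) k <= a k `^ p.
Proof.
move=> p01 a0; case: k => [|k] /=; first by rewrite sumle0.
have A0 := sumle_ge0 k a0; rewrite sumleS; set A := sumle a k in A0 *.
have h (x y : R) : 0 <= x -> 0 <= y -> x * (x + y) `^ (p - 1) <= x `^ p.
  by move=> x0 y0; rewrite powR_le_mul// x0 lerDl.
have := h _ _ A0 (a0 k.+1); have := h _ _ (a0 k.+1) A0.
rewrite [a k.+1 + _]addrC => h1 h2; rewrite lerBlDl.
have /andP[p0 _] := p01.
by rewrite -(mulr_powRB1 (addr_ge0 A0 (a0 k.+1)) p0) mulrDl lerD.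
Qed.

Lemma dominated_le1 M p u v rho : 0 < p <= 1 -> (forall k, 0 < v k) ->
  (forall k, (k < M)%N -> maxge M u k `^ p * (v k)^-1 <= rho k) ->
  dominated M p u v (maxle_inv v) rho 1.
Proof.
move=> p01 v0 hrho a a0; have c0 k : 0 <= a k `^ p * v k.
  by rewrite mulr_ge0 ?powR_ge0 ?ltW.
have bc k : diff (fun k => sumle a k `^ p) k <= (v k)^-1 * (a k `^ p * v k).
  by rewrite mulrC mulfK ?gt_eqF// diff_powR_le.
exists (fun k => a k `^ p * v k); split=> //.
- move=> k _; apply: le_trans (bc k) _; rewrite /= ler_wpM2r//.
  exact: (@maxle_ge_term _ (fun k => (v k)^-1)).
- move=> k kM; apply: le_trans (ler_wpM2l (powR_ge0 _ _) (bc k)) _.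
  by rewrite /= [leLHS]mulrA ler_wpM2r// hrho.
- by rewrite mul1r.
Qed.

Lemma maxle_attained (f : nat -> R) n : (forall k, 0 <= f k) ->
  exists2 k, (k <= n)%N & maxle f n = f k.
Proof.
move=> f0; elim: n => [|n [k kn ih]]; first by exists 0%N; rewrite ?maxle0.
rewrite maxleS; have [_|_] := leP (maxle f n) (f n.+1); first by exists n.+1.
by exists k => //; apply: leqW.
Qed.

(** A point mass at an index i <= k where 1/v is maximal, of height v_i^(-1/p). *)
Lemma attained_max M p v : 0 < p -> (forall k, 0 < v k) ->
  attained M p v (maxle_inv v).
Proof.
move=> p0 v0 k kM.
have [|i ik iE] := @maxle_attained (fun k => (v k)^-1) k.
  by move=> j; rewrite invr_ge0 ltW.
rewrite /maxle_inv iE; pose a j := if j == i then v i `^ (- (1 / p)) else 0.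
have ai : a i `^ p = (v i)^-1.
  rewrite /a eqxx -powRrM -(powR_inv1 (ltW (v0 i))).
  by congr (_ `^ _); field; rewrite gt_eqF.
exists a; split.
- by move=> j; rewrite /a; case: ifP => // _; exact: powR_ge0.
- rewrite /sumge (bigD1_seq i) ?mem_index_iota ?iota_uniq/= ?(leq_ltn_trans ik)//.
  rewrite big1 ?addr0 => [|j /negbTE ji]; last first.
    by rewrite /a ji powR0 ?gt_eqF// mul0r.
  by rewrite ai mulVf ?gt_eqF.
- rewrite -ai powR_le_iff ?powR_ge0//; last 2 first.
  + by rewrite /a eqxx powR_ge0.
  + by apply: sumle_ge0 => j; rewrite /a; case: ifP => // _; exact: powR_ge0.
  apply: sumle_ge_term => // j; rewrite /a; case: ifP => // _; exact: powR_ge0.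
Qed.

Lemma attained_inv M p v : 0 < p -> (forall k, 0 < v k) ->
  attained M p v (fun k => (v k)^-1).
Proof.
move=> p0 v0 k kM; have [a [a0 aN ak]] := attained_max p0 v0 kM.
exists a; split=> //; apply: le_trans ak.
exact: (@maxle_ge_term _ (fun k => (v k)^-1)).
Qed.

End FiniteCases.

(** * The four estimates for finite sequences *)

Section FiniteEquivalences.
Context {R : realType}.
Implicit Types (a u v w : nat -> R) (M n k : nat) (p q C : R).

Definition fin_functional := nat -> (nat -> R) -> (nat -> R) -> (nat -> R) -> R.

(** [K] is chosen before [M] and the sequences; this uniformity survives the limit. As v > 0,
    negative powers are ordinary ones. *)
Definition fin_upper p q (G : fin_functional) := exists2 K, 0 < K &
  forall M u v w a, (forall k, 0 <= u k) -> (forall k, 0 < v k) ->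
    (forall k, 0 <= w k) -> (forall k, 0 <= a k) ->
    finL M q u w a <= K * G M u v w * finN M p v a.

Definition fin_lower p q (G : fin_functional) := exists2 K, 0 < K &
  forall M u v w C, (forall k, 0 <= u k) -> (forall k, 0 < v k) ->
    (forall k, 0 <= w k) -> 0 <= C ->
    (forall a, (forall k, 0 <= a k) -> finL M q u w a <= C * finN M p v a) ->
    G M u v w <= K * C.

Definition finG1 p q : fin_functional := fun M u v w =>
  maxge M (fun n =>
    (maxge M u n `^ q * sumle w n
     + sumge M (fun i => maxge M u i `^ q * w i) n) `^ (1 / q)
    * sumle (fun k => v k `^ (1 / (1 - p))) n `^ ((p - 1) / p)) 0.

Definition finG2 p q : fin_functional := fun M u v w =>
  sumge M (fun n =>
    sumge M (fun i => maxge M u i `^ q * w i) n `^ (q / (p - q))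
    * (maxge M u n `^ q * w n)
    * sumle (fun k => v k `^ (1 / (1 - p))) n `^ ((p - 1) * q / (p - q))) 0
      `^ ((p - q) / (p * q))
  + sumge M (fun n => sumle w n `^ (q / (p - q)) * w n
    * maxge M (fun k => maxge M u k `^ (p * q / (p - q))
        * sumle (fun j => v j `^ (1 / (1 - p))) k `^ ((p - 1) * q / (p - q))) n) 0
      `^ ((p - q) / (p * q)).

Definition finG3 p q : fin_functional := fun M u v w =>
  maxge M (fun n =>
    (maxge M u n `^ q * sumle w n
     + sumge M (fun i => maxge M u i `^ q * w i) n) `^ (1 / q)
    * maxle (fun j => v j `^ (- (1 / p))) n) 0.

Definition finG4 p q : fin_functional := fun M u v w =>
  (sumge M (fun n =>
    sumge M (fun i => w i * maxge M u i `^ q) n `^ (q / (p - q))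
    * (maxge M u n `^ q * w n) * maxle (fun k => v k `^ (q / (q - p))) n) 0
  + sumge M (fun n => sumle w n `^ (q / (p - q)) * w n
    * maxge M (fun k => maxge M u k `^ (p * q / (p - q))
        * v k `^ (q / (q - p))) n) 0) `^ ((p - q) / (p * q)).

(** Removes the running maximum from [tail_sum] when [kap] is already nondecreasing, as the dual
    sums and [maxle_inv] are. *)
Lemma maxle_homo (f : nat -> R) n : (forall k, 0 <= f k) ->
  {homo f : i j / (i <= j)%N >-> i <= j} -> maxle f n = f n.
Proof.
move=> f0 fm; apply/eqP; rewrite eq_le maxle_ge_term// andbT.
by apply: maxle_le => // k kn; exact: fm.
Qed.

Lemma dual_sum_powR_mono p v r : 0 <= r -> (forall k, 0 < v k) ->
  {homo (fun n => dual_sum p v n `^ r) : i j / (i <= j)%N >-> i <= j}.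
Proof.
move=> r0 v0 i j ij; rewrite ge0_ler_powR ?nnegrE ?(ltW (dual_sum_gt0 _ _ _))//.
by apply: sumle_mono => // k; exact: powR_ge0.
Qed.

Lemma finG1E M p q u v w :
  finG1 p q M u v w = sup_bound M p q u w (fun n => dual_sum p v n `^ (p - 1)).
Proof.
apply: eq_maxge => n _; congr (_ * _).
rewrite /= -/(dual_sum p v n).
by rewrite -[RHS]powRrM div1r.
Qed.

Lemma finG2E M p q u v w : 1 < p -> 0 < q -> q < p -> (forall k, 0 < v k) ->
  finG2 p q M u v w =
  tail_sum M p q u w (fun n => dual_sum p v n `^ (p - 1)) `^ ((p - q) / (p * q)) +
  head_sum M p q w (fun n => maxge M u n `^ p * dual_sum p v n `^ (p - 1))
    `^ ((p - q) / (p * q)).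
Proof.
move=> p1 q0 qp v0; have r0 : 0 < q / (p - q) by rewrite divr_gt0 ?subr_gt0.
have p10 : 0 <= p - 1 by rewrite subr_ge0 ltW.
congr (_ `^ _ + _ `^ _).
  apply: eq_sumge => n _; congr (_ * _).
  rewrite maxle_homo => [|k|i j ij]; last 2 first.
  - exact: powR_ge0.
  - by rewrite powR_le_iff ?powR_ge0// dual_sum_powR_mono.
  by rewrite -[RHS]powRrM mulrA.
apply: eq_sumge => n _; congr (_ * _); apply: eq_maxge => k _.
rewrite [RHS]powRM ?powR_ge0//; congr (_ * _).
  by rewrite -[RHS]powRrM mulrA.
by rewrite -[RHS]powRrM mulrA.
Qed.

Lemma maxle_inv_powR v n r : 0 < r -> (forall k, 0 < v k) ->
  maxle_inv v n `^ r = maxle (fun k => v k `^ (- r)) n.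
Proof.
move=> r0 v0; rewrite /maxle_inv -maxle_powR// => [|k]; last by rewrite invr_ge0 ltW.
apply: eq_maxle => k _.
by rewrite -powR_inv1 ?(ltW (v0 k))// -powRrM mulN1r.
Qed.

Lemma finG3E M p q u v w : 0 < p -> (forall k, 0 < v k) ->
  finG3 p q M u v w = sup_bound M p q u w (maxle_inv v).
Proof.
move=> p0 v0; apply: eq_maxge => n _; congr (_ * _).
by rewrite maxle_inv_powR// divr_gt0.
Qed.

Lemma finG4E M p q u v w : 0 < p -> 0 < q -> q < p -> (forall k, 0 < v k) ->
  finG4 p q M u v w =
  (tail_sum M p q u w (maxle_inv v) +
   head_sum M p q w (fun n => maxge M u n `^ p * (v n)^-1)) `^ ((p - q) / (p * q)).
Proof.
move=> p0 q0 qp v0; have r0 : 0 < q / (p - q) by rewrite divr_gt0 ?subr_gt0.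
have rE : q / (q - p) = - (q / (p - q)) by rewrite -opprB invrN mulrN.
have k0 k : 0 <= maxle_inv v k by exact: maxle_ge0.
congr (_ `^ _); congr (_ + _).
  apply: eq_sumge => n _; congr (_ `^ _ * _ * _).
    by apply: eq_sumge => i _; rewrite mulrC.
  rewrite rE [RHS]maxle_homo => [|k|i j ij]; last 2 first.
  - exact: powR_ge0.
  - by rewrite powR_le_iff ?k0//; exact: maxle_mono.
  by rewrite maxle_inv_powR.
apply: eq_sumge => n _; congr (_ * _); apply: eq_maxge => k _.
rewrite powRM ?powR_ge0 ?invr_ge0 ?(ltW (v0 k))// -powRrM mulrA; congr (_ * _).
by rewrite -(powR_inv1 (ltW (v0 k))) -[RHS]powRrM mulN1r rE.
Qed.

Lemma finG1_upper p q : 1 < p -> p <= q -> fin_upper p q (finG1 p q).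
Proof.
move=> p1 pq; have p0 : 0 < p by apply: lt_trans p1.
exists ((2 `^ (q / p) * 2 * (2 `^ p) `^ (q / p)) `^ (1 / q)).
  by rewrite powR_gt0 ?mulr_gt0 ?powR_gt0.
move=> M u v w a u0 v0 w0 a0; rewrite finG1E.
have v0' k : 0 <= v k by rewrite ltW.
have k0 k : 0 <= dual_sum p v k `^ (p - 1) by exact: powR_ge0.
have dom := @dominated_gt1 _ M p u v p1 v0.
exact: (finL_le_sup p0 pq (powR_ge0 2 p) u0 v0' w0 a0 k0 dom).
Qed.

Lemma finG1_lower p q : 1 < p -> 0 < q -> fin_lower p q (finG1 p q).
Proof.
move=> p1 q0; have p0 : 0 < p by apply: lt_trans p1.
exists (2 `^ (1 / q)); first by rewrite powR_gt0.
move=> M u v w C u0 v0 w0 C0 hC; rewrite finG1E.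
have v0' k : 0 <= v k by rewrite ltW.
have k0 k : 0 <= dual_sum p v k `^ (p - 1) by exact: powR_ge0.
have hk := @attained_gt1 _ M p v p1 v0.
exact: (sup_bound_le p0 q0 C0 u0 v0' w0 k0 hk hC).
Qed.

Lemma finG2_upper p q : 1 < p -> 0 < q -> q < p -> fin_upper p q (finG2 p q).
Proof.
move=> p1 q0 qp; have p0 : 0 < p by apply: lt_trans p1.
exists ((2 `^ (q / p) * ((1 - q / p)^-1 `^ (q / p) * 2 `^ (1 - q / p)) *
   (2 `^ p) `^ (q / p) * 2) `^ (1 / q)).
  have := ratio01 p0 q0 qp => /andP[t0 t1].
  by rewrite powR_gt0 ?mulr_gt0 ?powR_gt0// invr_gt0 subr_gt0.
move=> M u v w a u0 v0 w0 a0; rewrite finG2E//.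
have v0' k : 0 <= v k by rewrite ltW.
have k0 k : 0 <= dual_sum p v k `^ (p - 1) by exact: powR_ge0.
have r0 k : 0 <= maxge M u k `^ p * dual_sum p v k `^ (p - 1).
  by rewrite mulr_ge0 ?powR_ge0.
have dom := @dominated_gt1 _ M p u v p1 v0.
exact: (finL_le_sum p0 q0 qp (powR_ge0 2 p) u0 v0' w0 a0 k0 r0 dom).
Qed.

Lemma finG2_lower p q : 1 < p -> 0 < q -> q < p -> fin_lower p q (finG2 p q).
Proof.
move=> p1 q0 qp; have p0 : 0 < p by apply: lt_trans p1.
set K := (2 * (2 * (1 + q / (p - q))) `^ (q / (p - q))) `^ ((p - q) / (p * q)).
have K0 : 0 < K.
  rewrite powR_gt0 ?mulr_gt0 ?powR_gt0// ?mulr_gt0 ?addr_gt0// divr_gt0//.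
  by rewrite subr_gt0.
exists (K + K); first by rewrite addr_gt0.
move=> M u v w C u0 v0 w0 C0 hC; rewrite finG2E// [leRHS]mulrDl.
have v0' k : 0 <= v k by rewrite ltW.
have k0 k : 0 <= dual_sum p v k `^ (p - 1) by exact: powR_ge0.
have hk := @attained_gt1 _ M p v p1 v0.
by apply: lerD; [exact: (tail_sum_le p0 q0 qp C0 u0 v0' w0 k0 hk hC)
                |exact: (head_sum_le p0 q0 qp C0 u0 v0' w0 k0 hk hC)].
Qed.

Lemma finG3_upper p q : 0 < p <= 1 -> p <= q -> fin_upper p q (finG3 p q).
Proof.
move=> p01 pq; have /andP[p0 _] := p01.
exists ((2 `^ (q / p) * 2 * 1 `^ (q / p)) `^ (1 / q)).
  by rewrite powR_gt0 ?mulr_gt0 ?powR_gt0.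
move=> M u v w a u0 v0 w0 a0; rewrite finG3E//.
have v0' k : 0 <= v k by rewrite ltW.
have k0 k : 0 <= maxle_inv v k by exact: maxle_ge0.
apply: (finL_le_sup p0 pq ler01 u0 v0' w0 a0 k0).
apply: dominated_le1 => // k kM; rewrite ler_wpM2l ?powR_ge0//.
exact: (@maxle_ge_term _ (fun k => (v k)^-1)).
Qed.

Lemma finG3_lower p q : 0 < p -> 0 < q -> fin_lower p q (finG3 p q).
Proof.
move=> p0 q0; exists (2 `^ (1 / q)); first by rewrite powR_gt0.
move=> M u v w C u0 v0 w0 C0 hC; rewrite finG3E//.
have v0' k : 0 <= v k by rewrite ltW.
have k0 k : 0 <= maxle_inv v k by exact: maxle_ge0.
have hk := @attained_max _ M p v p0 v0.
exact: (sup_bound_le p0 q0 C0 u0 v0' w0 k0 hk hC).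
Qed.

Lemma finG4_upper p q : 0 < p <= 1 -> 0 < q -> q < p -> fin_upper p q (finG4 p q).
Proof.
move=> p01 q0 qp; have /andP[p0 _] := p01.
set K := (2 `^ (q / p) * ((1 - q / p)^-1 `^ (q / p) * 2 `^ (1 - q / p)) *
   1 `^ (q / p) * 2) `^ (1 / q).
have K0 : 0 < K.
  have := ratio01 p0 q0 qp => /andP[t0 t1].
  by rewrite powR_gt0 ?mulr_gt0 ?powR_gt0// invr_gt0 subr_gt0.
exists (K * 2); first by rewrite mulr_gt0.
move=> M u v w a u0 v0 w0 a0; rewrite finG4E//.
have v0' k : 0 <= v k by rewrite ltW.
have k0 k : 0 <= maxle_inv v k by exact: maxle_ge0.
have r0 k : 0 <= maxge M u k `^ p * (v k)^-1.
  by rewrite mulr_ge0 ?powR_ge0 ?invr_ge0.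
have dom : dominated M p u v (maxle_inv v) (fun k => maxge M u k `^ p * (v k)^-1) 1.
  exact: dominated_le1.
apply: le_trans (finL_le_sum p0 q0 qp ler01 u0 v0' w0 a0 k0 r0 dom) _.
rewrite -/K ler_wpM2r ?powR_ge0// -mulrA ler_wpM2l ?(ltW K0)//.
(* Both sums stand under one outer power here, so the sum of the two powers must be compared with
   the power of the sum. *)
apply: powR_addr_ge.
- by apply: sumge_ge0 => n; rewrite !mulr_ge0 ?powR_ge0 ?maxle_ge0.
- by apply: sumge_ge0 => n; rewrite !mulr_ge0 ?powR_ge0 ?maxge_ge0.
- by rewrite divr_gt0 ?mulr_gt0 ?subr_gt0.
Qed.

Lemma finG4_lower p q : 0 < p -> 0 < q -> q < p -> fin_lower p q (finG4 p q).
Proof.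
move=> p0 q0 qp.
set K := (2 * (2 * (1 + q / (p - q))) `^ (q / (p - q))) `^ ((p - q) / (p * q)).
have pq0 : 0 < p - q by rewrite subr_gt0.
have K0 : 0 < K.
  by rewrite powR_gt0 ?mulr_gt0 ?powR_gt0// ?mulr_gt0 ?addr_gt0// divr_gt0.
exists (2 `^ ((p - q) / (p * q)) * (K + K)).
  by rewrite mulr_gt0 ?powR_gt0 ?addr_gt0.
move=> M u v w C u0 v0 w0 C0 hC; rewrite finG4E// -[leRHS]mulrA [(K + K) * C]mulrDl.
have v0' k : 0 <= v k by rewrite ltW.
have k0 k : 0 <= maxle_inv v k by exact: maxle_ge0.
have i0 k : 0 <= (v k)^-1 by rewrite invr_ge0.
apply: le_trans (powR_addr_le _ _ _) _.
- by apply: sumge_ge0 => n; rewrite !mulr_ge0 ?powR_ge0 ?maxle_ge0.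
- by apply: sumge_ge0 => n; rewrite !mulr_ge0 ?powR_ge0 ?maxge_ge0.
- by rewrite divr_gt0 ?mulr_gt0.
rewrite ler_wpM2l ?powR_ge0// lerD//.
  by apply: (tail_sum_le p0 q0 qp C0 u0 v0' w0 k0 _ hC); exact: attained_max.
by apply: (head_sum_le p0 q0 qp C0 u0 v0' w0 i0 _ hC); exact: attained_inv.
Qed.

End FiniteEquivalences.

(** * Monotone limits *)

Local Open Scope ereal_scope.

Section MonotoneLimits.
Context {R : realType}.
Implicit Types (x y : nat -> R) (l s : \bar R) (m N : nat) (k n : int).

Definition mono_from m x l := [/\
  forall N, (m <= N)%N -> (0 <= x N)%R,
  forall N N', (m <= N <= N')%N -> (x N <= x N')%R,
  forall N, (m <= N)%N -> (x N)%:E <= l &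
  forall s, (forall N, (m <= N)%N -> (x N)%:E <= s) -> l <= s].

Lemma mono_from_le m m' x l : (m <= m')%N -> mono_from m x l -> mono_from m' x l.
Proof.
move=> mm' [x0 xm xl lx]; split.
- by move=> N /(leq_trans mm')/x0.
- by move=> N N' /andP[m'N NN']; rewrite xm// NN' (leq_trans mm').
- by move=> N /(leq_trans mm')/xl.
- move=> s hs; apply: lx => N mN; apply: le_trans (hs (maxn N m') (leq_maxr _ _)).
  by rewrite lee_fin xm// mN leq_maxl.
Qed.

Lemma mono_from_ge0 m x l : mono_from m x l -> 0 <= l.
Proof. by case=> x0 _ xl _; apply: le_trans (xl m (leqnn m)); rewrite lee_fin x0. Qed.

Lemma eq_mono_from m x y l : (forall N, (m <= N)%N -> x N = y N) ->
  mono_from m x l -> mono_from m y l.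
Proof.
move=> xy [x0 xm xl lx]; split.
- by move=> N mN; rewrite -xy// x0.
- by move=> N N' /andP[mN NN']; rewrite -!xy ?(leq_trans mN)// xm// mN.
- by move=> N mN; rewrite -xy// xl.
- by move=> s hs; apply: lx => N mN; rewrite xy// hs.
Qed.

Lemma mono_from_cst m (c : R) : (0 <= c)%R -> mono_from m (fun=> c) c%:E.
Proof. by move=> c0; split=> // s /(_ m (leqnn m)). Qed.

Lemma mono_fromD m x y l l' : mono_from m x l -> mono_from m y l' ->
  mono_from m (fun N => x N + y N)%R (l + l').
Proof.
move=> hx hy; have l0 := mono_from_ge0 hx; have l'0 := mono_from_ge0 hy.
case: hx hy => [x0 xm xl lx] [y0 ym yl ly]; split.
- by move=> N mN; rewrite addr_ge0 ?x0 ?y0.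
- by move=> N N' h; rewrite lerD ?xm ?ym.
- by move=> N mN; rewrite EFinD leeD ?xl ?yl.
(* By monotonicity a bound on the diagonal holds for independent indices, so one limit can be taken
   at a time. *)
- move=> s hs; have xys N N' : (m <= N)%N -> (m <= N')%N ->
      (x N)%:E + (y N')%:E <= s.
    move=> mN mN'; apply: le_trans (hs (maxn N N') _); last first.
      by rewrite (leq_trans mN)// leq_maxl.
    by rewrite -EFinD lee_fin lerD ?xm ?ym ?mN ?mN' ?leq_maxl ?leq_maxr.
  have xls N : (m <= N)%N -> (x N)%:E + l' <= s.
    move=> mN; rewrite addeC -leeBrDr//; apply: ly => N' mN'.
    by rewrite leeBrDr// addeC xys.
  have [->|sy] := eqVneq s +oo; first by rewrite leey.
  have l'fin : l' \is a fin_num.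
    rewrite ge0_fin_numE// ltey; apply: contra_neq sy => l'y.
    by have := xls m (leqnn m); rewrite l'y addey// leye_eq => /eqP.
  by rewrite -leeBrDr//; apply: lx => N mN; rewrite leeBrDr// xls.
Qed.

Lemma mono_fromM m x y l l' : mono_from m x l -> mono_from m y l' ->
  mono_from m (fun N => x N * y N)%R (l * l').
Proof.
move=> hx hy; have l0 := mono_from_ge0 hx; have l'0 := mono_from_ge0 hy.
case: hx hy => [x0 xm xl lx] [y0 ym yl ly]; split.
- by move=> N mN; rewrite mulr_ge0 ?x0 ?y0.
- move=> N N' /[dup] h /andP[mN _].
  by rewrite ler_pM ?xm ?ym ?x0 ?y0.
- by move=> N mN; rewrite EFinM lee_pmul ?lee_fin ?xl ?yl ?x0 ?y0.
- move=> s hs; have s0 : 0 <= s.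
    by apply: le_trans (hs m (leqnn m)); rewrite lee_fin mulr_ge0 ?x0 ?y0.
  have xys N N' : (m <= N)%N -> (m <= N')%N -> (x N * y N')%:E <= s.
    move=> mN mN'; apply: le_trans (hs (maxn N N') _); last first.
      by rewrite (leq_trans mN)// leq_maxl.
    by rewrite lee_fin ler_pM ?xm ?ym ?x0 ?y0 ?mN ?mN' ?leq_maxl ?leq_maxr.
  have xls N : (m <= N)%N -> (x N)%:E * l' <= s.
    move=> mN; have := x0 N mN; rewrite le_eqVlt => /predU1P[<-|xN].
      by rewrite mul0e.
    rewrite -lee_pdivlMl//; apply: ly => N' mN'.
    by rewrite lee_pdivlMl// -EFinM xys.
  have := l'0; rewrite le_eqVlt => /predU1P[<-|l'p]; first by rewrite mule0.
  case: l' {ly yl l'0} l'p xls => [r|_|//].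
    rewrite lte_fin => r0 xls; rewrite muleC -lee_pdivlMl//; apply: lx => N mN.
    by rewrite lee_pdivlMl// muleC xls.
  (* The case l' = +oo: one positive [x N] makes every bound infinite; otherwise l = 0 and the
     convention 0 times +oo = 0 applies. *)
  move=> xls; have [[N mN xN]|nx] := pselect (exists2 N, (m <= N)%N & (0 < x N)%R).
    have := xls N mN; rewrite gt0_muley ?lte_fin// leye_eq => /eqP->.
    by rewrite leey.
  have -> : l = 0; last by rewrite mul0e.
  apply/eqP; rewrite eq_le l0 andbT; apply: lx => N mN; rewrite lee_fin leNgt.
  by apply/negP => xN; apply: nx; exists N.
Qed.

Lemma mono_from_powR m x l (r : R) : (0 < r)%R -> mono_from m x l ->
  mono_from m (fun N => x N `^ r)%R (l `^ r).
Proof.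
move=> r0 hx; have l0 := mono_from_ge0 hx; case: hx => [x0 xm xl lx].
have poweR_le (a b : \bar R) t : (0 <= t)%R -> 0 <= a -> a <= b -> a `^ t <= b `^ t.
  move=> t0 a0 ab; apply: gt0_ler_poweR => //; rewrite in_itv/= leey andbT//.
  exact: le_trans ab.
split.
- by move=> N _; exact: powR_ge0.
- move=> N N' /[dup] h /andP[mN NN']; rewrite powR_le_iff ?xm ?x0//.
  exact: leq_trans NN'.
- by move=> N mN; rewrite -poweR_EFin poweR_le ?xl ?lee_fin ?x0// ltW.
- move=> s hs; have s0 : 0 <= s.
    by apply: le_trans (hs m (leqnn m)); rewrite lee_fin powR_ge0.
  have rV0 : (0 <= r^-1)%R by rewrite invr_ge0 ltW.
  have : l <= s `^ r^-1.
    apply: lx => N mN.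
    have -> : (x N)%:E = ((x N)%:E `^ r) `^ r^-1.
      by rewrite -poweRrM mulfV ?gt_eqF// poweRe1// lee_fin x0.
    by apply: poweR_le => //; [exact: poweR_ge0|rewrite poweR_EFin hs].
  move=> /(poweR_le _ _ _ (ltW r0) l0); rewrite -poweRrM mulVf ?gt_eqF//.
  by rewrite poweRe1.
Qed.

(** Position of k in the window [-N, N], listed from 0 to 2N. The absolute value only converts to
    [nat] and is meaningful for |k| <= N. *)
Definition idx N k : nat := `|(k + N%:Z)%R|%N.

Lemma idxK N (i : nat) : idx N (i%:Z - N%:Z)%R = i.
Proof. by rewrite /idx subrK absz_nat. Qed.

Lemma idx_sub N k : (`|k| <= N)%N -> ((idx N k)%:Z - N%:Z)%R = k.
Proof. by rewrite /idx; lia. Qed.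

Lemma idx_window N (i : nat) : (i < N.*2.+1)%N -> (`|(i%:Z - N%:Z)%R| <= N)%N.
Proof. by lia. Qed.

Definition window N (A : set int) : set int := [set k | (`|k| <= N)%N /\ A k].

(** Within the window, [A] is the index interval from [a] to [b], with [b] excluded. *)
Definition traces N (A : set int) (a b : nat) :=
  (b <= N.*2.+1)%N /\ forall k, (`|k| <= N)%N -> (a <= idx N k < b)%N <-> A k.

Lemma traces_le N n : (`|n| <= N)%N ->
  traces N [set` `]-oo, n]] 0 (idx N n).+1.
Proof.
move=> nN; split=> [|k kN]; first by rewrite /idx; lia.
by rewrite /= in_itv/= ltnS /idx; split; lia.
Qed.

Lemma traces_ge N n : (`|n| <= N)%N ->
  traces N [set` `[n, +oo[] (idx N n) N.*2.+1.
Proof.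
move=> nN; split=> // k kN.
by rewrite /= in_itv/= andbT /idx; split; lia.
Qed.

Lemma traces_setT N : traces N [set: int] 0 N.*2.+1.
Proof. by split=> // k kN; split=> // _; rewrite /idx; lia. Qed.

Lemma sum_windowE N A a b (f : nat -> R) : traces N A a b ->
  (forall i, (a <= i < b)%N -> (0 <= f i)%R) ->
  (\sum_(a <= i < b) f i)%:E = \esum_(k in window N A) (f (idx N k))%:E.
Proof.
move=> [bN tr] f0.
pose t := [seq (i%:Z - N%:Z)%R | i <- index_iota a b].
have tE k : (k \in t) = `[< window N A k >].
  apply/idP/asboolP => [/mapP[i]|[kN Ak]].
    rewrite mem_index_iota => iab ->.
    have iN : (`|(i%:Z - N%:Z)%R| <= N)%N.
      by apply: idx_window; case/andP: iab => _ /leq_trans; apply.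
    by split=> //; apply/(tr _ iN); rewrite idxK.
  apply/mapP; exists (idx N k); last by rewrite idx_sub.
  by rewrite mem_index_iota; apply/tr.
have tu : uniq t.
  by rewrite map_inj_uniq ?iota_uniq// => i j; lia.
have WE : window N A = [set` t].
  by apply/seteqP; split=> k /=; rewrite tE => /asboolP.
have finT : finite_set [set` t] by exact: finite_seq.
rewrite WE esum_fset//; last first.
  move=> k; rewrite inE/= => /mapP[i]; rewrite mem_index_iota => iab ->.
  by rewrite lee_fin idxK f0.
rewrite -fsbig_seq// big_map sumEFin; congr (_%:E).
by apply: eq_bigr => i _; rewrite idxK.
Qed.

Lemma esum_subset (A B : set int) (F : int -> \bar R) : A `<=` B ->
  (forall k, B k -> 0 <= F k) -> \esum_(k in A) F k <= \esum_(k in B) F k.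
Proof.
move=> AB F0; rewrite esum_mkcond [leRHS]esum_mkcond; apply: le_esum => k _.
case: ifPn => [/set_mem/AB Bk|_]; first by rewrite mem_set.
by case: ifPn => // /set_mem/F0.
Qed.

Lemma mono_from_sum_seq (f : nat -> int -> R) (F : int -> \bar R) m t :
  (forall k, k \in t -> mono_from m (f ^~ k) (F k)) ->
  mono_from m (fun N => \sum_(k <- t) f N k)%R (\sum_(k <- t) F k).
Proof.
elim: t => [|k t ih] h.
  rewrite big_nil; apply: eq_mono_from (mono_from_cst m (lexx 0%R)) => N _.
  by rewrite big_nil.
rewrite big_cons.
have hk : mono_from m (f ^~ k) (F k) by apply: h; rewrite mem_head.
have ht : mono_from m (fun N => \sum_(k <- t) f N k)%R (\sum_(k <- t) F k).
  by apply: ih => j jt; apply: h; rewrite in_cons jt orbT.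
by apply: eq_mono_from (mono_fromD hk ht) => N _; rewrite big_cons.
Qed.

(** Monotone convergence in which both the terms and the range grow with N. *)
Lemma mono_from_sum (A : set int) m (a b : nat -> nat) (f : nat -> nat -> R)
    (F : int -> \bar R) :
  (forall N, (m <= N)%N -> traces N A (a N) (b N)) ->
  (forall k, mono_from `|k| (fun N => f N (idx N k)) (F k)) ->
  mono_from m (fun N => \sum_(a N <= i < b N) f N i)%R (\esum_(k in A) F k).
Proof.
move=> tr h; have f0 N k : (`|k| <= N)%N -> (0 <= f N (idx N k))%R.
  by case: (h k) => /(_ N).
have f0' N i : (m <= N)%N -> (a N <= i < b N)%N -> (0 <= f N i)%R.
  move=> mN /andP[_ ib]; rewrite -(idxK N i) f0//.
  by apply: idx_window; rewrite (leq_trans ib)//; case: (tr N mN).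
have F0 k : 0 <= F k by exact: mono_from_ge0 (h k).
have sE N : (m <= N)%N -> (\sum_(a N <= i < b N) f N i)%:E =
    \esum_(k in window N A) (f N (idx N k))%:E.
  by move=> mN; apply: sum_windowE (tr N mN) _ => i; exact: f0'.
split.
- move=> N mN; rewrite big_nat_cond; apply: sumr_ge0 => i; rewrite andbT.
  exact: f0'.
- move=> N N' /andP[mN NN']; rewrite -lee_fin !sE ?(leq_trans mN)//.
  apply: (@le_trans _ _ (\esum_(k in window N A) (f N' (idx N' k))%:E)).
    by apply: le_esum => k [kN _]; rewrite lee_fin; case: (h k) => _ -> //;
      rewrite kN.
  apply: esum_subset => [k [kN Ak]|k [kN _]]; last by rewrite lee_fin f0.
  by split=> //; apply: leq_trans NN'.
- move=> N mN; rewrite sE//.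
  apply: (@le_trans _ _ (\esum_(k in window N A) F k)).
    by apply: le_esum => k [kN _]; case: (h k) => _ _ ->.
  by apply: esum_subset => // k [].
- move=> s hs; apply: ge_ereal_sup => _ [X [finX XA] <-].
  rewrite fsbig_finite//=; set t := finmap.enum_fset _.
  have tX k : (k \in t) = (k \in X) by rewrite -in_fset_set.
  (* From [M] on the window contains the whole finite set [X]. *)
  pose M := maxn m (\max_(k <- t) `|k|%N).
  have tM k : k \in t -> (`|k| <= M)%N.
    move=> kt; rewrite leq_max; apply/orP; right.
    by rewrite (big_rem k)//= leq_maxl.
  have [_ _ _ -> // N MN] := @mono_from_sum_seq (fun N k => f N (idx N k)) F M t
    (fun k kt => mono_from_le (tM k kt) (h k)).
  have mN : (m <= N)%N by apply: leq_trans MN; exact: leq_maxl.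
  apply: le_trans (hs N mN); rewrite sE// -sumEFin.
  rewrite -(fsbig_finite _ (fun k => (f N (idx N k))%:E) finX) -esum_fset//.
    apply: esum_subset => [k Xk|k [kN _]]; last by rewrite lee_fin f0.
    split; last exact: XA.
    by apply: leq_trans (tM k _) MN; rewrite tX inE.
  move=> k; rewrite inE => Xk; rewrite lee_fin f0//.
  by apply: leq_trans (tM k _) MN; rewrite tX inE.
Qed.

(** Nonemptiness of [A] makes the supremum nonnegative, in agreement with finite maxima that start
    from 0. *)
Lemma mono_from_max (A : set int) m (a b : nat -> nat) (f : nat -> nat -> R)
    (F : int -> \bar R) : A !=set0 ->
  (forall N, (m <= N)%N -> traces N A (a N) (b N)) ->
  (forall k, mono_from `|k| (fun N => f N (idx N k)) (F k)) ->
  mono_from m (fun N => \big[Num.max/0]_(a N <= i < b N) f N i)%R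
    (ereal_sup [set F k | k in A]).
Proof.
move=> [k0 Ak0] tr h; have F0 k : 0 <= F k by exact: mono_from_ge0 (h k).
have kE N i : (m <= N)%N -> (a N <= i < b N)%N ->
    exists k, [/\ i = idx N k, (`|k| <= N)%N & A k].
  move=> mN iab; have [bN trN] := tr N mN; exists (i%:Z - N%:Z)%R.
  have iN : (`|(i%:Z - N%:Z)%R| <= N)%N.
    by apply: idx_window; case/andP: iab => _ /leq_trans; apply.
  by rewrite idxK; split=> //; apply/(trN _ iN); rewrite idxK.
have max_le N z : (0 <= z)%R -> (forall i, (a N <= i < b N)%N -> (f N i <= z)%R) ->
    (\big[Num.max/0]_(a N <= i < b N) f N i <= z)%R.
  exact: (@maxge_le R (b N) (f N) (a N)).
have max_ge N i : (a N <= i < b N)%N ->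
    (f N i <= \big[Num.max/0]_(a N <= i < b N) f N i)%R.
  exact: (@maxge_ge_term R (b N) (f N) (a N)).
have max0 N : (0 <= \big[Num.max/0]_(a N <= i < b N) f N i)%R.
  exact: bigmax_ge_id.
split=> //.
- move=> N N' /andP[mN NN']; apply: max_le => // i /(kE _ _ mN)[k [-> kN Ak]].
  have [_ /(_ N N') hk _ _] := h k; apply: le_trans (hk _) _; first by rewrite kN.
  have mN' := leq_trans mN NN'.
  by apply: max_ge; apply/(proj2 (tr N' mN')) => //; exact: leq_trans NN'.
- move=> N mN; have sup0 : 0 <= ereal_sup [set F k | k in A].
    by apply: le_trans (F0 k0) _; apply: ereal_sup_ubound; exists k0.
  case supE : (ereal_sup _) sup0 => [z| |//] z0; last by rewrite leey.
  rewrite lee_fin; apply: max_le => // i /(kE _ _ mN)[k [-> kN Ak]].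
  have [_ _ /(_ N kN) hk _] := h k; rewrite -lee_fin; apply: le_trans hk _.
  by rewrite -supE; apply: ereal_sup_ubound; exists k.
- move=> s hs; apply: ge_ereal_sup => _ [k Ak <-].
  have [_ _ _ ->//] := mono_from_le (leq_maxl `|k|%N m) (h k).
  move=> N; rewrite geq_max => /andP[kN mN]; apply: le_trans (hs N mN).
  by rewrite lee_fin max_ge//; apply/(proj2 (tr N mN)).
Qed.

Lemma mono_from_sumle (f : nat -> nat -> R) (F : int -> \bar R) n :
  (forall k, mono_from `|k| (fun N => f N (idx N k)) (F k)) ->
  mono_from `|n| (fun N => sumle (f N) (idx N n)) (\esum_(k in `]-oo, n]) F k).
Proof. by move=> h; apply: mono_from_sum => // N; exact: traces_le. Qed.

Lemma mono_from_sumge (f : nat -> nat -> R) (F : int -> \bar R) n :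
  (forall k, mono_from `|k| (fun N => f N (idx N k)) (F k)) ->
  mono_from `|n| (fun N => sumge N.*2.+1 (f N) (idx N n))
    (\esum_(k in `[n, +oo[) F k).
Proof. by move=> h; apply: mono_from_sum => // N; exact: traces_ge. Qed.

Lemma mono_from_sumT (f : nat -> nat -> R) (F : int -> \bar R) :
  (forall k, mono_from `|k| (fun N => f N (idx N k)) (F k)) ->
  mono_from 0 (fun N => sumge N.*2.+1 (f N) 0) (\esum_(k in [set: int]) F k).
Proof. by move=> h; apply: mono_from_sum => // N _; exact: traces_setT. Qed.

Lemma mono_from_maxle (f : nat -> nat -> R) (F : int -> \bar R) n :
  (forall k, mono_from `|k| (fun N => f N (idx N k)) (F k)) ->
  mono_from `|n| (fun N => maxle (f N) (idx N n))
    (ereal_sup [set F k | k in `]-oo, n]]).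
Proof.
move=> h; apply: mono_from_max => // [|N]; last exact: traces_le.
by exists n; rewrite /= in_itv/= lexx.
Qed.

Lemma mono_from_maxge (f : nat -> nat -> R) (F : int -> \bar R) n :
  (forall k, mono_from `|k| (fun N => f N (idx N k)) (F k)) ->
  mono_from `|n| (fun N => maxge N.*2.+1 (f N) (idx N n))
    (ereal_sup [set F k | k in `[n, +oo[]).
Proof.
move=> h; apply: mono_from_max => // [|N]; last exact: traces_ge.
by exists n; rewrite /= in_itv/= lexx.
Qed.

Lemma mono_from_maxT (f : nat -> nat -> R) (F : int -> \bar R) :
  (forall k, mono_from `|k| (fun N => f N (idx N k)) (F k)) ->
  mono_from 0 (fun N => maxge N.*2.+1 (f N) 0)
    (ereal_sup [set F k | k in [set: int]]).
Proof.
move=> h; apply: mono_from_max => // [|N _]; last exact: traces_setT.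
by exists 0%R.
Qed.

Definition shift N (u : int -> R) (i : nat) : R := u (i%:Z - N%:Z)%R.

Lemma mono_from_shift (u : int -> R) k : (0 <= u k)%R ->
  mono_from `|k| (fun N => shift N u (idx N k)) (u k)%:E.
Proof.
move=> u0; apply: eq_mono_from (mono_from_cst `|k|%N u0) => N kN.
by rewrite /shift idx_sub.
Qed.

(** The perturbation decreases to 0, so the negative powers increase, and to +oo exactly where v
    vanishes, as [epow] prescribes. *)
Lemma mono_from_epow (v : int -> R) (e r : R) k : (0 <= v k)%R -> (0 < e)%R ->
  (r < 0)%R ->
  mono_from `|k| (fun N => (shift N v (idx N k) + e / N.+1%:R) `^ r)%R
    (epow (v k)%:E r).
Proof.
move=> v0 e0 r0; have rN0 : (0 < - r)%R by rewrite oppr_gt0.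
set z := v k in v0 *.
suff : mono_from `|k| (fun N => (z + e / N.+1%:R) `^ r)%R (epow z%:E r).
  by apply: eq_mono_from => N kN; rewrite /shift idx_sub.
have eN N : (0 < e / N.+1%:R)%R by rewrite divr_gt0.
have zN N : (0 < z + e / N.+1%:R)%R by rewrite ltr_wpDl.
have powE (t : R) : (t `^ r = (t `^ (- r))^-1)%R by rewrite -powRN opprK.
have epowE : epow z%:E r = (z%:E `^ (- r))^-1 by rewrite /epow leNgt r0.
have decr (t t' : R) : (0 < t)%R -> (t <= t')%R -> (t' `^ r <= t `^ r)%R.
  move=> t0 tt'; rewrite !powE lef_pV2 ?posrE ?powR_gt0 ?(lt_le_trans t0)//.
  by rewrite powR_le_iff// ltW// (lt_le_trans t0).
split.
- by move=> N _; exact: powR_ge0.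
- move=> N N' /andP[_ NN']; apply: decr => //.
  by rewrite lerD2l ler_pM2l// lef_pV2 ?posrE// ler_nat.
- move=> N _; rewrite epowE poweR_EFin inver; case: ifPn => zz; first by rewrite leey.
  rewrite -powE lee_fin decr//; last by rewrite lerDl ltW.
  rewrite lt_neqAle v0 andbT eq_sym; apply: contra zz => /eqP->.
  by rewrite powR0// gt_eqF.
- move=> s hs; have [->|sy] := eqVneq s +oo; first by rewrite leey.
  have s0 : 0 < s.
    by apply: lt_le_trans (hs _ (leqnn _)); rewrite lte_fin powR_gt0.
  case: s hs sy s0 => [s|//|//] hs _; rewrite lte_fin => s0.
  (* A finite bound s on all the powers forces s^(1/r) <= z + e/(N+1) for all large N, hence s^(1/r)
     <= z; in particular z > 0. *)
  have zs : (s^-1 `^ (- r)^-1 <= z)%R.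
    apply/ler_addgt0Pr => d d0.
    have [N0 hN0] : exists N0 : nat, (e / d < N0.+1%:R)%R.
      by eexists; exact: truncnS_gt.
    pose N := maxn `|k|%N N0.
    have edN : (e / N.+1%:R <= d)%R.
      rewrite ler_pdivrMr// mulrC -ler_pdivrMr// (le_trans (ltW hN0))//.
      by rewrite ler_nat ltnS leq_maxr.
    apply: le_trans (lerD (lexx z) edN).
    rewrite -(powR_le_iff _ (ltW (zN N)) rN0) ?powR_ge0//.
    rewrite powRVK ?invr_ge0 ?(ltW s0) ?gt_eqF//.
    rewrite -[leRHS]invrK lef_pV2 ?posrE ?invr_gt0 ?powR_gt0//.
    by rewrite -powE -lee_fin hs// leq_maxl.
  have z0 : (0 < z)%R by apply: lt_le_trans zs; rewrite powR_gt0 ?invr_gt0.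
  rewrite epowE poweR_EFin inver gt_eqF ?powR_gt0// lee_fin.
  rewrite -[leRHS]invrK lef_pV2 ?posrE ?invr_gt0 ?powR_gt0//.
  rewrite -[leLHS](@powRVK _ _ (- r)) ?invr_ge0 ?(ltW s0) ?gt_eqF//.
  by rewrite powR_le_iff ?powR_ge0.
Qed.

End MonotoneLimits.

(** * Passage from finite windows to double-infinite sequences *)

Section Reduction.
Context {R : realType}.
Implicit Types (u v w a : int -> R) (p q e : R).

Definition perturb N v e (i : nat) : R := (shift N v i + e / N.+1%:R)%R.

Lemma perturb_gt0 N v e i : nonneg_seq v -> (0 < e)%R -> (0 < perturb N v e i)%R.
Proof. by move=> v0 e0; rewrite ltr_wpDl ?v0// divr_gt0. Qed.

Lemma mono_from_uhat u k : nonneg_seq u ->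
  mono_from `|k| (fun N => maxge N.*2.+1 (shift N u) (idx N k)) (uhat u k).
Proof. by move=> u0; apply: mono_from_maxge => j; exact: mono_from_shift. Qed.

Lemma mono_from_uhat_powR u k (r : R) : nonneg_seq u -> (0 < r)%R ->
  mono_from `|k| (fun N => maxge N.*2.+1 (shift N u) (idx N k) `^ r)%R
    (uhat u k `^ r).
Proof. by move=> u0 r0; apply: mono_from_powR => //; exact: mono_from_uhat. Qed.

Lemma mono_from_hardy_lhs q u w a : (0 < q)%R ->
  nonneg_seq u -> nonneg_seq w -> nonneg_seq a ->
  mono_from 0 (fun N => finL N.*2.+1 q (shift N u) (shift N w) (shift N a))
    (hardy_lhs q u w a).
Proof.
move=> q0 u0 w0 a0; apply: mono_from_powR; first by rewrite divr_gt0.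
apply: mono_from_sumT => n; apply: mono_fromM; last exact: mono_from_shift.
apply: mono_from_powR => //; apply: mono_from_maxge => i.
apply: mono_fromM; first exact: mono_from_shift.
by apply: mono_from_sumle => k; exact: mono_from_shift.
Qed.

Lemma mono_from_hardy_rhs p v a : (0 < p)%R -> nonneg_seq v -> nonneg_seq a ->
  mono_from 0 (fun N => finN N.*2.+1 p (shift N v) (shift N a))
    (hardy_rhs p v a).
Proof.
move=> p0 v0 a0; apply: mono_from_powR; first by rewrite divr_gt0.
apply: mono_from_sumT => n; apply: mono_fromM; last exact: mono_from_shift.
by apply: mono_from_powR => //; exact: mono_from_shift.
Qed.

Lemma eq_finL M q (u w a a' : nat -> R) :
  (forall i, (i < M)%N -> a i = a' i) -> finL M q u w a = finL M q u w a'.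
Proof.
move=> aa'; congr (_ `^ _)%R; apply: eq_sumge => n _; congr (_ `^ _ * _)%R.
apply: eq_maxge => i /andP[_ iM]; congr (_ * _)%R; apply: eq_sumle => k ki.
by rewrite aa'// (leq_ltn_trans ki).
Qed.

Lemma eq_finN M p (v a a' : nat -> R) :
  (forall i, (i < M)%N -> a i = a' i) -> finN M p v a = finN M p v a'.
Proof.
by move=> aa'; congr (_ `^ _)%R; apply: eq_sumge => n /andP[_ nM]; rewrite aa'.
Qed.

Lemma hardy_rhs_window N p v a : (0 < p)%R -> nonneg_seq v -> nonneg_seq a ->
  (forall k : int, (N < `|k|)%N -> a k = 0%R) ->
  hardy_rhs p v a = (finN N.*2.+1 p (shift N v) (shift N a))%:E.
Proof.
move=> p0 v0 a0 aN; rewrite /hardy_rhs /finN -poweR_EFin; congr (_ `^ _).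
rewrite /sumge (sum_windowE (traces_setT N)) => [|i _]; last first.
  by rewrite mulr_ge0 ?powR_ge0// v0.
rewrite esum_mkcond [RHS]esum_mkcond; apply: eq_esum => k _.
rewrite in_setT; case: ifPn => [/set_mem[kN _]|kW].
  by rewrite /shift !idx_sub// EFinM poweR_EFin.
rewrite aN ?poweR_EFin ?powR0 ?gt_eqF// ?mul0e// ltnNge; apply: contra kW => kN.
by rewrite mem_set.
Qed.

(** When G is finite, K G + d is shown to be admissible for every d > 0. The finite estimate
    involves a perturbed weight, and the perturbation is removed separately for each window. *)
Lemma best_const_le_of_fin p q (F : fin_functional) G : (0 < p)%R -> (0 < q)%R ->
  fin_upper p q F ->
  (forall u v w e, nonneg_seq u -> nonneg_seq v -> nonneg_seq w -> (0 < e)%R ->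
    mono_from 0 (fun N => F N.*2.+1 (shift N u) (perturb N v e) (shift N w))
      (G u v w)) ->
  lesssim_unif (best_const p q) G.
Proof.
move=> p0 q0 [K K0 up] lim; exists K; split=> // u v w u0 v0 w0.
have g0 : 0 <= G u v w by exact: mono_from_ge0 (lim u v w 1%R u0 v0 w0 ltr01).
case gE : (G u v w) g0 => [r| |//] r0; last by rewrite gt0_muley ?leey// lte_fin.
apply/lee_addgt0Pr => d d0; apply: ereal_inf_lbound.
have Kr0 : (0 <= K * r)%R by rewrite mulr_ge0 ?(ltW K0).
exists (K * r + d)%R; last by rewrite EFinD EFinM.
split=> [|a a0]; first by rewrite addr_ge0// ltW.
(* The slack d keeps the constant positive, so that it can be cancelled even if the right-hand norm
   is infinite. *)
have C0 : (0 < K * r + d)%R by rewrite ltr_wpDl.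
have [_ _ rhs_ge _] := mono_from_hardy_rhs p0 v0 a0.
have [_ _ _ lhs_le] := mono_from_hardy_lhs q0 u0 w0 a0.
apply: lhs_le => N _; apply: (@le_trans _ _
    ((K * r + d)%:E * (finN N.*2.+1 p (shift N v) (shift N a))%:E)); last first.
  by rewrite lee_pmul2l// rhs_ge.
rewrite -EFinM lee_fin.
set L := finL _ _ _ _ _; set S := finN _ _ _ _.
have S0 : (0 <= S)%R by exact: powR_ge0.
suff : (L <= K * r * S)%R by move=> /le_trans; apply; rewrite ler_wpM2r// lerDl ltW.
set M := N.*2.+1 in L S S0 *.
pose s := sumge M (fun n => shift N a n `^ p * shift N v n)%R 0.
pose s' := sumge M (fun n => shift N a n `^ p)%R 0.
have s0 : (0 <= s)%R by apply: sumge_ge0 => n; rewrite mulr_ge0 ?powR_ge0// v0.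
have s'0 : (0 <= s')%R by apply: sumge_ge0 => n; rewrite powR_ge0.
have L0 : (0 <= L)%R by exact: powR_ge0.
(* The perturbation parameter e (N + 1) turns the weight on this window into v + e, while the bound
   r is independent of it. Hence e may tend to 0 with N fixed. *)
have bound e : (0 < e)%R -> (L `^ p <= (K * r) `^ p * (s + s' * e))%R.
  move=> e0; have eN0 : (0 < e * N.+1%:R)%R by rewrite mulr_gt0.
  have vE : perturb N v (e * N.+1%:R) = (fun i => shift N v i + e)%R.
    by apply/funext => i; rewrite /perturb mulfK.
  have [/(_ N (leq0n _)) F0 _ /(_ N (leq0n _)) Fr _] := lim u v w _ u0 v0 w0 eN0.
  rewrite gE lee_fin vE in Fr; rewrite vE in F0.
  have LF := up M (shift N u) (fun i => shift N v i + e)%R (shift N w) (shift N a)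
    (fun k => u0 _) (fun k => ltr_wpDl (v0 _) e0) (fun k => w0 _) (fun k => a0 _).
  have LS : (L <= K * r * (s + s' * e) `^ (1 / p))%R.
    apply: le_trans LF _; apply: ler_pM.
    - exact: mulr_ge0 (ltW K0) F0.
    - exact: powR_ge0.
    - exact: ler_wpM2l (ltW K0) _ _ Fr.
    rewrite /finN (_ : sumge _ _ _ = s + s' * e)%R//.
    rewrite /s mulrC -sumgeZ -sumgeD; apply: eq_sumge => i _.
    by rewrite mulrDr [(e * _)%R]mulrC.
  have sse : (0 <= s + s' * e)%R by rewrite addr_ge0// mulr_ge0// ltW.
  rewrite -(powR_le_iff L0 (mulr_ge0 Kr0 (powR_ge0 _ _)) p0) in LS.
  by move: LS; rewrite powRM ?powR_ge0// div1r powRVK ?gt_eqF.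
rewrite -(powR_le_iff L0 (mulr_ge0 Kr0 S0) p0).
rewrite powRM// /S /finN -/s div1r powRVK ?gt_eqF//.
apply/ler_addgt0Pr => d' d'0.
have D0 : (0 < (K * r) `^ p * s' + 1)%R by rewrite ltr_wpDl// mulr_ge0 ?powR_ge0.
(* This e makes the excess at most d'; the added 1 keeps the denominator positive. *)
apply: le_trans (bound (d' / ((K * r) `^ p * s' + 1))%R _) _.
  by rewrite divr_gt0.
rewrite mulrDr lerD2l mulrA mulrA ler_pdivrMr// mulrC ler_wpM2l ?(ltW d'0)//.
by rewrite lerDl.
Qed.

(** Every admissible constant is admissible on each window with the perturbed weight, so the finite
    lower bound applies uniformly in N. *)
Lemma le_best_const_of_fin p q (F : fin_functional) G : (0 < p)%R -> (0 < q)%R ->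
  fin_lower p q F ->
  (forall u v w e, nonneg_seq u -> nonneg_seq v -> nonneg_seq w -> (0 < e)%R ->
    mono_from 0 (fun N => F N.*2.+1 (shift N u) (perturb N v e) (shift N w))
      (G u v w)) ->
  lesssim_unif G (best_const p q).
Proof.
move=> p0 q0 [K K0 lo] lim; exists K; split=> // u v w u0 v0 w0.
rewrite -lee_pdivrMl//; apply: le_ereal_inf_tmp => _ [C [C0 hC] <-].
rewrite lee_pdivrMl//.
have [_ _ _ lub] := lim u v w 1%R u0 v0 w0 ltr01.
apply: lub => N _; rewrite -EFinM lee_fin; apply: lo => // [k|k|k|b b0].
- exact: u0.
- exact: perturb_gt0.
- exact: w0.
(* Extension by zero: the right-hand norm is then that of the window, and the left-hand side
   dominates its truncation. *)
pose a (k : int) : R := if (`|k| <= N)%N then b (idx N k) else 0%R.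
have a0 : nonneg_seq a by move=> k; rewrite /a; case: ifP.
have ab i : (i < N.*2.+1)%N -> shift N a i = b i.
  by move=> iN; rewrite /shift /a idx_window// idxK.
have aN k : (N < `|k|)%N -> a k = 0%R by rewrite /a ltnNge => /negbTE->.
rewrite -(eq_finL _ _ _ ab) -(eq_finN _ _ ab).
have [_ _ /(_ N (leq0n _)) lhs_ge _] := mono_from_hardy_lhs q0 u0 w0 a0.
have := le_trans lhs_ge (hC a a0).
rewrite (hardy_rhs_window p0 v0 a0 aN) -EFinM lee_fin => /le_trans; apply.
(* Perturbing v only increases the right-hand norm. *)
rewrite ler_wpM2l// powR_le_iff ?divr_gt0//.
- apply: le_sumge => n _; rewrite ler_wpM2l ?powR_ge0// lerDl.
  by rewrite divr_ge0.
- by apply: sumge_ge0 => n; rewrite mulr_ge0 ?powR_ge0// v0.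
- by apply: sumge_ge0 => n; rewrite mulr_ge0 ?powR_ge0// ltW// perturb_gt0.
Qed.

Lemma approx_unif_of_fin p q (F : fin_functional) G : (0 < p)%R -> (0 < q)%R ->
  fin_upper p q F -> fin_lower p q F ->
  (forall u v w e, nonneg_seq u -> nonneg_seq v -> nonneg_seq w -> (0 < e)%R ->
    mono_from 0 (fun N => F N.*2.+1 (shift N u) (perturb N v e) (shift N w))
      (G u v w)) ->
  approx_unif (best_const p q) G.
Proof.
by move=> p0 q0 up lo lim; split;
  [exact: best_const_le_of_fin up lim|exact: le_best_const_of_fin lo lim].
Qed.

Lemma mono_from_dual_sum p v e n : (1 < p)%R -> nonneg_seq v -> (0 < e)%R ->
  mono_from `|n| (fun N => sumle (fun k => perturb N v e k `^ (1 / (1 - p)))%R (idx N n))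
    (\esum_(k in `]-oo, n]) epow (v k)%:E (1 / (1 - p))).
Proof.
move=> p1 v0 e0; apply: mono_from_sumle => k; apply: mono_from_epow => //.
by rewrite div1r invr_lt0 subr_lt0.
Qed.

Lemma mono_from_tail q u w n : (0 < q)%R -> nonneg_seq u -> nonneg_seq w ->
  mono_from `|n| (fun N => sumge N.*2.+1 (fun i =>
      maxge N.*2.+1 (shift N u) i `^ q * shift N w i)%R (idx N n))
    (\esum_(i in `[n, +oo[) (uhat u i `^ q * (w i)%:E)).
Proof.
move=> q0 u0 w0; apply: mono_from_sumge => i; apply: mono_fromM.
  exact: mono_from_uhat_powR.
exact: mono_from_shift.
Qed.

Lemma mono_from_head w n : nonneg_seq w ->
  mono_from `|n| (fun N => sumle (shift N w) (idx N n))
    (\esum_(i in `]-oo, n]) (w i)%:E).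
Proof. by move=> w0; apply: mono_from_sumle => i; exact: mono_from_shift. Qed.

End Reduction.

(** * The four estimates for double-infinite sequences *)

Unset Implicit Arguments.

Theorem theorem2p1 (R : realType) (p q : R) (p_gt0 : (0 < p)%R)
    (q_gt0 : (0 < q)%R) :
  ((1 < p)%R -> (p <= q)%R ->
   approx_unif (best_const p q) (fun u v w =>
     ereal_sup
       [set (uhat u n `^ q * (\esum_(i in `]-oo, n]) (w i)%:E)
             + \esum_(i in `[n, +oo[) (uhat u i `^ q * (w i)%:E)) `^ (1 / q)
            * (\esum_(k in `]-oo, n]) epow (v k)%:E (1 / (1 - p)))
                `^ ((p - 1) / p)
       | n in [set: int]]))
  /\
  ((1 < p)%R -> (q < p)%R ->
   approx_unif (best_const p q) (fun u v w =>
     (\esum_(n in [set: int])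
       ((\esum_(i in `[n, +oo[) (uhat u i `^ q * (w i)%:E)) `^ (q / (p - q))
        * (uhat u n `^ q * (w n)%:E)
        * (\esum_(k in `]-oo, n]) epow (v k)%:E (1 / (1 - p)))
            `^ ((p - 1) * q / (p - q)))) `^ ((p - q) / (p * q))
     +
     (\esum_(n in [set: int])
       ((\esum_(i in `]-oo, n]) (w i)%:E) `^ (q / (p - q))
        * (w n)%:E
        * ereal_sup
            [set uhat u k `^ (p * q / (p - q))
                 * (\esum_(j in `]-oo, k]) epow (v j)%:E (1 / (1 - p)))
                     `^ ((p - 1) * q / (p - q))
            | k in `[n, +oo[])) `^ ((p - q) / (p * q))))
  /\
  ((p <= 1)%R -> (p <= q)%R ->
   approx_unif (best_const p q) (fun u v w =>
     ereal_sup
       [set (uhat u n `^ q * (\esum_(i in `]-oo, n]) (w i)%:E)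
             + \esum_(k in `[n, +oo[) (uhat u k `^ q * (w k)%:E)) `^ (1 / q)
            * ereal_sup [set epow (v j)%:E (- (1 / p)) | j in `]-oo, n]]
       | n in [set: int]]))
  /\
  ((q < p)%R -> (p <= 1)%R ->
   approx_unif (best_const p q) (fun u v w =>
     (\esum_(n in [set: int])
       ((\esum_(i in `[n, +oo[) ((w i)%:E * uhat u i `^ q)) `^ (q / (p - q))
        * (uhat u n `^ q * (w n)%:E)
        * ereal_sup [set epow (v k)%:E (q / (q - p)) | k in `]-oo, n]])
      +
      \esum_(n in [set: int])
       ((\esum_(i in `]-oo, n]) (w i)%:E) `^ (q / (p - q))
        * (w n)%:E
        * ereal_sup
            [set uhat u k `^ (p * q / (p - q)) * epow (v k)%:E (q / (q - p))
            | k in `[n, +oo[])) `^ ((p - q) / (p * q)))).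
Proof.
(* Limits pass through positive powers only, so the signs of the exponents are settled first. In
   each case the limit is then taken along the structure of the expression. *)
have qV0 : (0 < 1 / q)%R by rewrite divr_gt0.
have pq0 : (q < p -> 0 < p - q)%R by rewrite subr_gt0.
have pq_q0 : (q < p -> 0 < q / (p - q))%R by move=> /pq0; exact: divr_gt0.
have pq_pq0 : (q < p -> 0 < p * q / (p - q))%R.
  by move=> /pq0; apply: divr_gt0; rewrite mulr_gt0.
have pq_r0 : (q < p -> 0 < (p - q) / (p * q))%R.
  by move=> /pq0 ?; rewrite divr_gt0// mulr_gt0.
have p1_0 : (1 < p -> 0 < p - 1)%R by rewrite subr_gt0.
split=> [p1 pq|]; last split=> [p1 qp|]; last split=> [p1 pq|qp p1].
- apply: (approx_unif_of_fin p_gt0 q_gt0 (finG1_upper p1 pq) (finG1_lower p1 q_gt0)).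
  move=> u v w e u0 v0 w0 e0; apply: mono_from_maxT => n.
  apply: mono_fromM; apply: mono_from_powR => //; last 2 first.
  + by rewrite divr_gt0 ?p1_0.
  + exact: mono_from_dual_sum.
  apply: mono_fromD; last exact: mono_from_tail.
  by apply: mono_fromM; [exact: mono_from_uhat_powR|exact: mono_from_head].
- have s0 : (0 < (p - 1) * q / (p - q))%R.
    by rewrite divr_gt0 ?pq0// mulr_gt0 ?p1_0.
  apply: (approx_unif_of_fin p_gt0 q_gt0 (finG2_upper p1 q_gt0 qp) (finG2_lower p1 q_gt0 qp)).
  move=> u v w e u0 v0 w0 e0.
  apply: mono_fromD; (apply: mono_from_powR; first exact: pq_r0);
    apply: mono_from_sumT => n; apply: mono_fromM.
  + apply: mono_fromM.
      by apply: mono_from_powR; [exact: pq_q0|exact: mono_from_tail].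
    by apply: mono_fromM; [exact: mono_from_uhat_powR|exact: mono_from_shift].
  + by apply: mono_from_powR => //; exact: mono_from_dual_sum.
  + apply: mono_fromM; last exact: mono_from_shift.
    by apply: mono_from_powR; [exact: pq_q0|exact: mono_from_head].
  + apply: mono_from_maxge => k; apply: mono_fromM.
      by apply: mono_from_uhat_powR => //; exact: pq_pq0.
    by apply: mono_from_powR => //; exact: mono_from_dual_sum.
- have p01 : (0 < p <= 1)%R by rewrite p_gt0.
  apply: (approx_unif_of_fin p_gt0 q_gt0 (finG3_upper p01 pq) (finG3_lower p_gt0 q_gt0)).
  move=> u v w e u0 v0 w0 e0; apply: mono_from_maxT => n.
  apply: mono_fromM; last first.
    apply: mono_from_maxle => k; apply: mono_from_epow => //.
    by rewrite oppr_lt0 divr_gt0.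
  apply: mono_from_powR => //; apply: mono_fromD; last exact: mono_from_tail.
  by apply: mono_fromM; [exact: mono_from_uhat_powR|exact: mono_from_head].
- have p01 : (0 < p <= 1)%R by rewrite p_gt0.
  have s0 : (q / (q - p) < 0)%R.
    by rewrite pmulr_rlt0// invr_lt0 subr_lt0.
  apply: (approx_unif_of_fin p_gt0 q_gt0 (finG4_upper p01 q_gt0 qp) (finG4_lower p_gt0 q_gt0 qp)).
  move=> u v w e u0 v0 w0 e0; apply: mono_from_powR; first exact: pq_r0.
  apply: mono_fromD; apply: mono_from_sumT => n; apply: mono_fromM.
  + apply: mono_fromM.
      apply: mono_from_powR; first exact: pq_q0.
      apply: mono_from_sumge => i.
      by apply: mono_fromM; [exact: mono_from_shift|exact: mono_from_uhat_powR].
    by apply: mono_fromM; [exact: mono_from_uhat_powR|exact: mono_from_shift].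
  + by apply: mono_from_maxle => k; exact: mono_from_epow.
  + apply: mono_fromM; last exact: mono_from_shift.
    by apply: mono_from_powR; [exact: pq_q0|exact: mono_from_head].
  + apply: mono_from_maxge => k; apply: mono_fromM; last exact: mono_from_epow.
    by apply: mono_from_uhat_powR => //; exact: pq_pq0.
Qed.
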